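(* Let $R$ be a topologically suitable ring. Let $G$ be a flat locally of finite presentation $R$-group scheme, let $Y$ be a locally of finite type $R$-scheme endowed with an action of $G$, and let $\pi:Y\to Y/G$ be the quotient morphism to the quotient stack. (1) The map $[\pi(R)]:Y(R)\to[(Y/G)(R)]$ is $G(R)$-invariant and continuous. (2) Assume that $G$ is special. Then $[\pi(R)]$ is surjective and open, and the continuous map $\overline{[\pi(R)]}:Y(R)/G(R)\to[(Y/G)(R)]$ induced by the $G(R)$-invariant map $[\pi(R)]$ is a homeomorphism.
   Context: A topologically suitable ring is a local topological ring $R$ such that the group of units $R^\times=\mathbb G_m(R)$ is open in $R$ and inversion $R^\times\to R^\times$ is continuous for the subspace topology. For $Y$ a locally of finite type $R$-scheme, $Y(R)$ is given the unique topology (Conrad) that is functorial in $Y$, compatible with fiber products, carries closed (open) immersions to embeddings (open embeddings), and is the given topology of $R$ for $Y=\mathbb A^1_R$. For a locally of finite type $R$-algebraic stack $X$, $[X(R)]$ denotes the set of isomorphism classes of objects of the groupoid $X(R)$, endowed with the finest topology such that for every $1$-morphism $f:U\to X$ with $U$ a locally of finite type $R$-scheme the map $[f(R)]:U(R)\to[X(R)]$ is continuous. An affine algebraic group $G$ is special if every $G$-torsor $T\to W$ with $T,W$ schemes is locally trivial for the Zariski topology on $W$. $Y(R)/G(R)$ has the quotient topology. *)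

(* Defs.v *)
(* Schemes are given by their functors of points.  Everything lives over a base
   ring k: "functor" means functor from commutative k-algebras to sets, and an
   affine scheme Spec B is the functor Hom_k(B, -).  Rings may be zero
   (comPzRingType), because the zero ring occurs among the members and the
   overlaps of coverings. *)
From HB Require Import structures.
From mathcomp Require Import all_boot all_algebra.
From mathcomp Require Import boolp classical_sets topology tvs.

Set Implicit Arguments.
Unset Strict Implicit.
Unset Printing Implicit Defensive.

Import GRing.Theory.

Local Open Scope classical_set_scope.
Local Open Scope ring_scope.

Lemma rmorph_ext (A B : comPzRingType) (f g : {rmorphism A -> B}) :
  f =1 g -> f = g.
Proof.
move=> /funext; case: f => f [[mf] [hf]]; case: g => g [[mg] [hg]] /= e.
by subst g; rewrite (Prop_irrelevance mf mg) (Prop_irrelevance hf hg).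
Qed.

Definition is_ideal (A : comPzRingType) (I : set A) : Prop :=
  [/\ I 0, forall x y, I x -> I y -> I (x + y) & forall a x, I x -> I (a * x)].

Definition is_maximal_ideal (A : comPzRingType) (I : set A) : Prop :=
  [/\ is_ideal I, ~ I 1 &
      forall J : set A, is_ideal J -> I `<=` J -> ~ J 1 -> J = I].

Definition is_local_ring (A : comPzRingType) : Prop :=
  exists! I : set A, is_maximal_ideal I.

(* The ideal generated by the image f(I) is the unit ideal. *)
Definition generates_unit_ideal (A B : comPzRingType) (f : A -> B) (I : set A)
    : Prop :=
  exists (n : nat) (a : 'I_n -> A) (b : 'I_n -> B),
    (forall i, I (a i)) /\ \sum_(i < n) b i * f (a i) = 1.

(* (c, x) makes P a polynomial ring A[x_0, ..., x_(n-1)]. *)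
Definition is_polynomial_ring (n : nat) (A P : comPzRingType)
    (c : {rmorphism A -> P}) (x : 'I_n -> P) : Prop :=
  forall (C : comPzRingType) (g : {rmorphism A -> C}) (y : 'I_n -> C),
    exists! h : {rmorphism P -> C},
      (forall a, h (c a) = g a) /\ (forall i, h (x i) = y i).

Definition finite_type (A B : comPzRingType) (f : {rmorphism A -> B}) : Prop :=
  exists (n : nat) (P : comPzRingType) (c : {rmorphism A -> P})
         (x : 'I_n -> P) (q : {rmorphism P -> B}),
    [/\ is_polynomial_ring c x,
        forall a, q (c a) = f a &
        forall b, exists p, q p = b].

Definition finite_presentation (A B : comPzRingType) (f : {rmorphism A -> B})
    : Prop :=
  exists (n : nat) (P : comPzRingType) (c : {rmorphism A -> P})
         (x : 'I_n -> P) (q : {rmorphism P -> B}) (m : nat) (r : 'I_m -> P),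
    [/\ is_polynomial_ring c x,
        forall a, q (c a) = f a,
        forall b, exists p, q p = b &
        forall p, q p = 0 <-> exists a : 'I_m -> P, p = \sum_(j < m) a j * r j].

(* A-bilinear maps M x B -> P, where B is an A-module through f. *)
Definition is_bilinear (A B : comPzRingType) (f : {rmorphism A -> B})
    (M P : lmodType A) (t : M -> B -> P) : Prop :=
  [/\ forall m m' b, t (m + m') b = t m b + t m' b,
      forall m b b', t m (b + b') = t m b + t m b',
      forall a m b, t (a *: m) b = a *: t m b &
      forall a m b, t m (f a * b) = a *: t m b].

(* t : M x B -> P exhibits P as the tensor product of M and B over A. *)
Definition is_tensor_product (A B : comPzRingType) (f : {rmorphism A -> B})
    (M P : lmodType A) (t : M -> B -> P) : Prop :=
  is_bilinear f t /\
  forall (Q : lmodType A) (s : M -> B -> Q), is_bilinear f s ->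
    exists! h : P -> Q, linear h /\ forall m b, h (t m b) = s m b.

Definition is_flat (A B : comPzRingType) (f : {rmorphism A -> B}) : Prop :=
  forall (M N P Q : lmodType A) (u : {linear M -> N})
         (t : M -> B -> P) (s : N -> B -> Q) (h : {linear P -> Q}),
    injective u -> is_tensor_product f t -> is_tensor_product f s ->
    (forall m b, h (t m b) = s (u m) b) -> injective h.

Record algebra (k : comPzRingType) := Algebra {
  alg_ring :> comPzRingType;
  alg_str : {rmorphism k -> alg_ring} }.

Record alg_hom (k : comPzRingType) (A B : algebra k) := AlgHom {
  alg_fun :> {rmorphism A -> B};
  alg_funE : forall a : k, alg_fun (alg_str A a) = alg_str B a }.

Lemma alg_hom_ext (k : comPzRingType) (A B : algebra k) (f g : alg_hom A B) :
  f =1 g -> f = g.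
Proof.
case: f => f hf; case: g => g hg /= /rmorph_ext e; subst g.
by rewrite (Prop_irrelevance hf hg).
Qed.

Definition alg_id (k : comPzRingType) (A : algebra k) : alg_hom A A :=
  @AlgHom k A A idfun (fun=> erefl).

Lemma alg_comp_subproof (k : comPzRingType) (A B C : algebra k)
    (g : alg_hom B C) (f : alg_hom A B) (a : k) :
  (g \o f) (alg_str A a) = alg_str C a.
Proof. by rewrite /= !alg_funE. Qed.

Definition alg_comp (k : comPzRingType) (A B C : algebra k)
    (g : alg_hom B C) (f : alg_hom A B) : alg_hom A C :=
  @AlgHom k A C (g \o f) (alg_comp_subproof g f).

Definition base_alg (k : comPzRingType) : algebra k := @Algebra k k idfun.

Definition str_hom (k : comPzRingType) (A : algebra k)
    : alg_hom (base_alg k) A :=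
  @AlgHom k (base_alg k) A (alg_str A) (fun=> erefl).

Record functor (k : comPzRingType) := Functor {
  fob :> algebra k -> Type;
  fmap : forall A B : algebra k, alg_hom A B -> fob A -> fob B;
  fmap_id : forall A x, fmap (alg_id A) x = x;
  fmap_comp : forall (A B C : algebra k) (g : alg_hom B C) (f : alg_hom A B) x,
    fmap (alg_comp g f) x = fmap g (fmap f x) }.

Record nat_trans (k : comPzRingType) (X Y : functor k) := NatTrans {
  nt :> forall A, X A -> Y A;
  nt_nat : forall (A B : algebra k) (f : alg_hom A B) x,
    nt (fmap f x) = fmap f (nt x) }.
Arguments nt {k X Y} n [A] x.

Lemma nat_trans_ext (k : comPzRingType) (X Y : functor k) (f g : nat_trans X Y) :
  (forall A (x : X A), f A x = g A x) -> f = g.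
Proof.
case: f => f hf; case: g => g hg /= e.
have {}e : f = g by apply: functional_extensionality_dep => A; apply: funext.
by subst g; rewrite (Prop_irrelevance hf hg).
Qed.

Definition nt_id (k : comPzRingType) (X : functor k) : nat_trans X X :=
  @NatTrans k X X (fun _ x => x) (fun _ _ _ _ => erefl).

Lemma nt_comp_subproof (k : comPzRingType) (X Y Z : functor k)
    (g : nat_trans Y Z) (f : nat_trans X Y) (A B : algebra k)
    (h : alg_hom A B) (x : X A) :
  g B (f B (fmap h x)) = fmap h (g A (f A x)).
Proof. by rewrite !nt_nat. Qed.

Definition nt_comp (k : comPzRingType) (X Y Z : functor k)
    (g : nat_trans Y Z) (f : nat_trans X Y) : nat_trans X Z :=
  @NatTrans k X Z (fun A x => g A (f A x)) (nt_comp_subproof g f).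

Definition is_iso (k : comPzRingType) (X Y : functor k) (f : nat_trans X Y)
    : Prop :=
  forall A, bijective (@nt k X Y f A).

Lemma spec_id (k : comPzRingType) (B A : algebra k) (h : alg_hom B A) :
  alg_comp (alg_id A) h = h.
Proof. exact: alg_hom_ext. Qed.

Lemma spec_comp (k : comPzRingType) (B A C D : algebra k) (g : alg_hom C D)
    (f : alg_hom A C) (h : alg_hom B A) :
  alg_comp (alg_comp g f) h = alg_comp g (alg_comp f h).
Proof. exact: alg_hom_ext. Qed.

Definition spec (k : comPzRingType) (B : algebra k) : functor k :=
  @Functor k (fun A => alg_hom B A) (fun A C f h => alg_comp f h)
    (@spec_id k B) (@spec_comp k B).

Definition affine_line (k : comPzRingType) : functor k :=
  @Functor k (fun A => A) (fun A B f x => f x)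
    (fun _ _ => erefl) (fun _ _ _ _ _ _ => erefl).

Definition prod_functor (k : comPzRingType) (X Y : functor k) : functor k.
Proof.
refine (@Functor k (fun A => X A * Y A)%type
  (fun A B f x => (fmap f x.1, fmap f x.2)) _ _).
- by move=> A [x y]; rewrite !fmap_id.
- by move=> A B C g f [x y]; rewrite !fmap_comp.
Defined.

Lemma fibre_prod_map_subproof (k : comPzRingType) (X Y S : functor k)
    (f : nat_trans X S) (g : nat_trans Y S) (A B : algebra k) (h : alg_hom A B)
    (p : {p : X A * Y A | f A p.1 = g A p.2}) :
  f B (fmap h (sval p).1) = g B (fmap h (sval p).2).
Proof. by rewrite !nt_nat (svalP p). Qed.

Definition fibre_prod (k : comPzRingType) (X Y S : functor k)
    (f : nat_trans X S) (g : nat_trans Y S) : functor k.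
Proof.
refine (@Functor k (fun A => {p : X A * Y A | f A p.1 = g A p.2})
  (fun A B h p => exist (fun p : X B * Y B => f B p.1 = g B p.2)
    (fmap h (sval p).1, fmap h (sval p).2)
    (fibre_prod_map_subproof h p)) _ _).
- by move=> A [[x y] e]; apply: eq_exist; rewrite /= !fmap_id.
- by move=> A B C u v [[x y] e]; apply: eq_exist; rewrite /= !fmap_comp.
Defined.

Lemma fibre_prod_ext (k : comPzRingType) (X Y S : functor k)
    (f : nat_trans X S) (g : nat_trans Y S) (A : algebra k)
    (p q : fibre_prod f g A) : sval p = sval q -> p = q.
Proof. by case: p q => [p hp] [q hq] /= e; exact: eq_exist. Qed.

Definition fibre_fst (k : comPzRingType) (X Y S : functor k)
    (f : nat_trans X S) (g : nat_trans Y S) : nat_trans (fibre_prod f g) X :=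
  @NatTrans k (fibre_prod f g) X (fun A p => (sval p).1)
    (fun _ _ _ _ => erefl).

Definition fibre_snd (k : comPzRingType) (X Y S : functor k)
    (f : nat_trans X S) (g : nat_trans Y S) : nat_trans (fibre_prod f g) Y :=
  @NatTrans k (fibre_prod f g) Y (fun A p => (sval p).2)
    (fun _ _ _ _ => erefl).

(* A finite family of homomorphisms A -> B_i that is an fppf covering of
   Spec A: flat, of finite presentation and jointly surjective.  A point of
   Spec A is represented by a homomorphism from A to a field, up to field
   extension. *)
Definition fppf_covering (k : comPzRingType) (A : algebra k) (n : nat)
    (B : 'I_n -> algebra k) (f : forall i, alg_hom A (B i)) : Prop :=
  (forall i, is_flat (f i) /\ finite_presentation (f i)) /\
  (forall (K : fieldType) (x : {rmorphism A -> K}),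
     exists (i : 'I_n) (L : fieldType) (e : {rmorphism K -> L})
            (y : {rmorphism B i -> L}), forall a, y (f i a) = e (x a)).

(* Agreement of the sections over all C receiving both B_i and B_j is the same
   as agreement over the tensor product of B_i and B_j over A. *)
Definition fppf_sheaf (k : comPzRingType) (X : functor k) : Prop :=
  forall (A : algebra k) (n : nat) (B : 'I_n -> algebra k)
         (f : forall i, alg_hom A (B i)),
    fppf_covering f ->
    forall s : (forall i, X (B i)),
      (forall (i j : 'I_n) (C : algebra k)
              (g : alg_hom (B i) C) (h : alg_hom (B j) C),
         alg_comp g (f i) = alg_comp h (f j) ->
         fmap g (s i) = fmap h (s j)) ->
      exists! x : X A, forall i, fmap (f i) x = s i.

(* For each x in X(A), i.e. each Spec A -> X, the pullback of j is the open
   subscheme of Spec A complementary to V(I). *)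
Definition open_immersion (k : comPzRingType) (U X : functor k)
    (j : nat_trans U X) : Prop :=
  (forall A, injective (@nt k U X j A)) /\
  forall (A : algebra k) (x : X A), exists I : set A, is_ideal I /\
    forall (C : algebra k) (f : alg_hom A C),
      (exists u : U C, j C u = fmap f x) <-> generates_unit_ideal f I.

(* Likewise, with the closed subscheme Spec (A / I). *)
Definition closed_immersion (k : comPzRingType) (Z X : functor k)
    (j : nat_trans Z X) : Prop :=
  (forall A, injective (@nt k Z X j A)) /\
  forall (A : algebra k) (x : X A), exists I : set A, is_ideal I /\
    forall (C : algebra k) (f : alg_hom A C),
      (exists z : Z C, j C z = fmap f x) <-> (forall a, I a -> f a = 0).

(* Each point of X has an affine open neighbourhood Spec B with P B. *)
Definition locally (k : comPzRingType) (P : algebra k -> Prop) (X : functor k)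
    : Prop :=
  forall (K : fieldType) (c : {rmorphism k -> K}) (x : X (@Algebra k K c)),
    exists (B : algebra k) (j : nat_trans (spec B) X),
      [/\ P B, open_immersion j & exists b, j _ b = x].

(* A scheme is a sheaf covered by open affine subschemes.  By faithfully flat
   descent the functors obtained are the same for the Zariski and for the fppf
   topology. *)
Definition is_scheme (k : comPzRingType) (X : functor k) : Prop :=
  fppf_sheaf X /\ locally (fun=> True) X.

Record scheme (k : comPzRingType) := Scheme {
  sch_functor :> functor k;
  sch_is_scheme : is_scheme sch_functor }.

Definition locally_finite_type (k : comPzRingType) (X : functor k) : Prop :=
  locally (fun B => finite_type (alg_str B)) X.

Definition locally_finite_presentation (k : comPzRingType) (X : functor k)
    : Prop :=
  locally (fun B => finite_presentation (alg_str B)) X.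

Definition flat_functor (k : comPzRingType) (X : functor k) : Prop :=
  locally (fun B => is_flat (alg_str B)) X.

Lemma spec_base_is_scheme (k : comPzRingType) : is_scheme (spec (base_alg k)).
Proof.
have uniq (A : algebra k) (h : spec (base_alg k) A) : h = str_hom A.
  by apply: alg_hom_ext => a; exact: (alg_funE h a).
split.
- move=> A n B f _ s _; exists (str_hom A); split=> [i|x _].
    by rewrite [RHS]uniq; exact: uniq.
  by rewrite [RHS]uniq.
- move=> K c x; exists (base_alg k), (nt_id _); split=> //; last by exists x.
  split=> [A y z //|A y].
  exists setT; split=> [|C f]; first by split.
  split=> _; last by exists (fmap f y).
  exists 1%N, (fun=> 1), (fun=> 1); split=> //.
  by rewrite big_ord1 rmorph1 mulr1.
Qed.

Definition spec_base (k : comPzRingType) : scheme k :=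
  Scheme (spec_base_is_scheme k).

(* The morphism Spec k -> X corresponding to a k-point of X. *)
Definition point_morphism (k : comPzRingType) (X : functor k)
    (x : X (base_alg k)) : nat_trans (spec_base k) X :=
  @NatTrans k (spec_base k) X (fun A h => fmap h x)
    (fun A B f h => fmap_comp f h x).

Record group_scheme (k : comPzRingType) := GroupScheme {
  gs_scheme :> scheme k;
  gs_mul : forall A, gs_scheme A -> gs_scheme A -> gs_scheme A;
  gs_one : forall A, gs_scheme A;
  gs_inv : forall A, gs_scheme A -> gs_scheme A;
  gs_mulA : forall A (x y z : gs_scheme A),
    gs_mul x (gs_mul y z) = gs_mul (gs_mul x y) z;
  gs_mul1 : forall A (x : gs_scheme A), gs_mul (gs_one A) x = x;
  gs_mulV : forall A (x : gs_scheme A), gs_mul (gs_inv x) x = gs_one A;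
  gs_mul_nat : forall (A B : algebra k) (f : alg_hom A B) (x y : gs_scheme A),
    fmap f (gs_mul x y) = gs_mul (fmap f x) (fmap f y) }.

Record action (k : comPzRingType) (G : group_scheme k) (Y : functor k) :=
    Action {
  act :> forall A, G A -> Y A -> Y A;
  act_nat : forall (A B : algebra k) (f : alg_hom A B) (g : G A) (y : Y A),
    fmap f (act g y) = act (fmap f g) (fmap f y);
  act_one : forall A (y : Y A), act (gs_one G A) y = y;
  act_mul : forall A (g h : G A) (y : Y A),
    act (gs_mul g h) y = act g (act h y) }.
Arguments act {k G Y} a [A] g y.

Definition equivariant (k : comPzRingType) (G : group_scheme k)
    (X Y : functor k) (a : action G X) (b : action G Y) (f : nat_trans X Y)
    : Prop :=
  forall A (g : G A) (x : X A), f A (act a g x) = act b g (f A x).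

(* The total space of a torsor is an fppf sheaf, not necessarily a scheme. *)
Record torsor (k : comPzRingType) (G : group_scheme k) (W : scheme k) :=
    Torsor {
  tot :> functor k;
  tact : action G tot;
  proj : nat_trans tot W;
  torsor_sheaf : fppf_sheaf tot;
  proj_act : forall A (g : G A) (t : tot A), proj A (act tact g t) = proj A t;
  torsor_simply_transitive : forall A (t t' : tot A),
    proj A t = proj A t' -> exists! g : G A, act tact g t = t';
  torsor_locally_nonempty : forall (A : algebra k) (w : W A),
    exists (n : nat) (B : 'I_n -> algebra k) (f : forall i, alg_hom A (B i)),
      fppf_covering f /\
      forall i, exists t : tot (B i), proj (B i) t = fmap (f i) w }.

Definition torsor_iso (k : comPzRingType) (G : group_scheme k) (W : scheme k)
    (T T' : torsor G W) : Prop :=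
  exists e : nat_trans T T',
    [/\ is_iso e, equivariant (tact T) (tact T') e &
        nt_comp (proj T') e = proj T].

Section GroupTheory.
Variables (k : comPzRingType) (G : group_scheme k) (A : algebra k).
Implicit Types x y z : G A.

Lemma gs_mulr_inv x : gs_mul x (gs_inv x) = gs_one G A.
Proof.
rewrite -[LHS]gs_mul1 -{1}(gs_mulV (gs_inv x)) -gs_mulA.
by rewrite [X in gs_mul _ X]gs_mulA gs_mulV gs_mul1 gs_mulV.
Qed.

Lemma gs_mulr1 x : gs_mul x (gs_one G A) = x.
Proof. by rewrite -(gs_mulV x) gs_mulA gs_mulr_inv gs_mul1. Qed.

Lemma gs_mul_cancelr x y z : gs_mul y x = gs_mul z x -> y = z.
Proof.
move=> e; rewrite -[y]gs_mulr1 -[z]gs_mulr1 -(gs_mulr_inv x) !gs_mulA.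
by rewrite e.
Qed.
End GroupTheory.


Lemma is_flat_id (A : comPzRingType) (f : {rmorphism A -> A}) :
  f =1 id -> is_flat f.
Proof.
move=> fE M N P Q u t s h u_inj tP sP hE.
have retract (L T : lmodType A) (v : L -> A -> T) : is_tensor_product f v ->
    exists g : T -> L, (forall m, g (v m 1) = m) /\ (forall p, v (g p) 1 = p).
  move=> [[vDl vDr vZl vZr] univ].
  have [|g [[glin gE] _]] := univ L (fun m b => b *: m).
    split=> [m m' b|m b b'|a m b|a m b].
    - by rewrite scalerDr.
    - by rewrite scalerDl.
    - by rewrite !scalerA mulrC.
    - by rewrite fE scalerA.
  exists g; split=> [m|p]; first by rewrite gE scale1r.
  have [|g1 [_ g1_uniq]] := univ T v; first by split.
  have e1 : g1 = id by apply: g1_uniq; split.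
  suff -> : v (g p) 1 = g1 p by rewrite e1.
  suff -> : g1 = fun p => v (g p) 1 by [].
  apply: g1_uniq; split=> [a x y|m b].
    by rewrite glin vDl vZl.
  by rewrite gE vZl -vZr fE mulr1.
have [g [gK Kg]] := retract _ _ _ tP.
have [g' [gK' _]] := retract _ _ _ sP.
move=> p q epq; rewrite -(Kg p) -(Kg q); congr (t _ 1); apply: u_inj.
by rewrite -(gK' (u (g p))) -(gK' (u (g q))) -!hE !Kg epq.
Qed.

Lemma finite_presentation_id (A : comPzRingType) (f : {rmorphism A -> A}) :
  f =1 id -> finite_presentation f.
Proof.
move=> fE; exists 0%N, A, idfun, (fun=> 0), idfun, 0%N, (fun=> 0); split.
- move=> C g y; exists g; split; first by split=> // -[].
  by move=> h [hE _]; apply: rmorph_ext => z; rewrite -hE.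
- by move=> a; rewrite /= fE.
- by move=> b; exists b.
- move=> p; split=> [/= ->|[a ->]]; last by rewrite big_ord0.
  by exists (fun=> 0); rewrite big_ord0.
Qed.

Lemma fppf_covering_id (k : comPzRingType) (A : algebra k) :
  fppf_covering (fun _ : 'I_1 => alg_id A).
Proof.
split=> [i|K x].
  by split; [exact: is_flat_id|exact: finite_presentation_id].
by exists ord0, K, idfun, x.
Qed.

Lemma fppf_sheaf_fibre_prod (k : comPzRingType) (X Y S : functor k)
    (f : nat_trans X S) (g : nat_trans Y S) :
  fppf_sheaf X -> fppf_sheaf Y -> fppf_sheaf S -> fppf_sheaf (fibre_prod f g).
Proof.
move=> shX shY shS A n B c cov s sE.
have [|x [xE x_uniq]] := shX A n B c cov (fun i => (sval (s i)).1).
  by move=> i j C u v /(sE i j) /(congr1 sval) /(congr1 fst).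
have [|y [yE y_uniq]] := shY A n B c cov (fun i => (sval (s i)).2).
  by move=> i j C u v /(sE i j) /(congr1 sval) /(congr1 snd).
have exy : f A x = g A y.
  have [|z [_ z_uniq]] := shS A n B c cov (fun i => f _ (sval (s i)).1).
    move=> i j C u v /(sE i j) /(congr1 sval) /(congr1 fst) /= e.
    by rewrite -!nt_nat e.
  rewrite -(z_uniq (f A x)) => [|i]; last by rewrite -nt_nat xE.
  by apply: z_uniq => i; rewrite -nt_nat yE (svalP (s i)).
exists (exist _ (x, y) exy); split=> [i|[[x' y'] e'] H].
  by apply: fibre_prod_ext; rewrite /= xE yE -surjective_pairing.
apply: fibre_prod_ext => /=; rewrite (x_uniq x') ?(y_uniq y') // => i.
  by rewrite -(H i).
by rewrite -(H i).
Qed.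

Lemma fppf_sheaf_prod (k : comPzRingType) (X Y : functor k) :
  fppf_sheaf X -> fppf_sheaf Y -> fppf_sheaf (prod_functor X Y).
Proof.
move=> shX shY A n B c cov s sE.
have [|x [xE x_uniq]] := shX A n B c cov (fun i => (s i).1).
  by move=> i j C u v /(sE i j) /(congr1 fst).
have [|y [yE y_uniq]] := shY A n B c cov (fun i => (s i).2).
  by move=> i j C u v /(sE i j) /(congr1 snd).
exists (x, y); split=> [i|[x' y'] H].
  by rewrite /= xE yE -surjective_pairing.
by rewrite (x_uniq x') ?(y_uniq y') // => i; rewrite -(H i).
Qed.

Section PullbackTorsor.
Variables (k : comPzRingType) (G : group_scheme k) (U W : scheme k).
Variables (j : nat_trans U W) (T : torsor G W).

Let E := fibre_prod j (proj T).

Lemma pullback_act_subproof (A : algebra k) (g : G A) (p : E A) :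
  j A (sval p).1 = proj T A (act (tact T) g (sval p).2).
Proof. by rewrite proj_act (svalP p). Qed.

Definition pullback_action : action G E.
Proof.
refine (@Action k G E
  (fun A g p => exist _ ((sval p).1, act (tact T) g (sval p).2)
                        (pullback_act_subproof g p)) _ _ _).
- by move=> A B f g p; apply: fibre_prod_ext; rewrite /= act_nat.
- by move=> A [[u t] e]; apply: fibre_prod_ext; rewrite /= act_one.
- by move=> A g h [[u t] e]; apply: fibre_prod_ext; rewrite /= act_mul.
Defined.

Definition pullback_torsor : torsor G U.
Proof.
refine (@Torsor k G U E pullback_action (fibre_fst j (proj T)) _ _ _ _).
- apply: fppf_sheaf_fibre_prod; [|exact: torsor_sheaf|].
    by case: (sch_is_scheme U).
  by case: (sch_is_scheme W).
- by [].
- move=> A [[u t] /= e] [[u' t'] /= e'] /= uu'; subst u'.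
  have [|g [gE g_uniq]] := @torsor_simply_transitive _ _ _ T A t t'.
    by rewrite -e -e'.
  exists g; split; first by apply: fibre_prod_ext; rewrite /= gE.
  by move=> g' /(congr1 sval) /= [/g_uniq].
- move=> A u.
  have [n [B [f [cov tE]]]] := torsor_locally_nonempty T (j A u).
  exists n, B, f; split=> // i; have [t e] := tE i.
  have e' : j (B i) (fmap (f i) u) = proj T (B i) t by rewrite nt_nat e.
  by exists (exist _ (fmap (f i) u, t) e').
Defined.

End PullbackTorsor.

Section TrivialTorsor.
Variables (k : comPzRingType) (G : group_scheme k) (S : scheme k).

Let E := prod_functor G S.

Definition trivial_action : action G E.
Proof.
refine (@Action k G E (fun A g p => (gs_mul g p.1, p.2)) _ _ _).
- by move=> A B f g p; rewrite /= gs_mul_nat.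
- by move=> A [g s]; rewrite /= gs_mul1.
- by move=> A g h [g' s]; rewrite /= gs_mulA.
Defined.

Definition trivial_proj : nat_trans E S :=
  @NatTrans k E S (fun A p => p.2) (fun _ _ _ _ => erefl).

Definition trivial_torsor : torsor G S.
Proof.
refine (@Torsor k G S E trivial_action trivial_proj _ _ _ _).
- apply: fppf_sheaf_prod; first by case: (sch_is_scheme G).
  by case: (sch_is_scheme S).
- by [].
- move=> A [g s] [g' s'] /= <-.
  exists (gs_mul g' (gs_inv g)); split=> [|h [/= hE]].
    by rewrite /= -gs_mulA gs_mulV gs_mulr1.
  by rewrite -hE -gs_mulA gs_mulr_inv gs_mulr1.
- move=> A s; exists 1%N, (fun=> A), (fun=> alg_id A).
  split=> [|i]; first exact: fppf_covering_id.
  by exists (gs_one G A, s); rewrite fmap_id.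
Defined.

End TrivialTorsor.

Definition zariski_locally_trivial (k : comPzRingType) (G : group_scheme k)
    (W : scheme k) (T : torsor G W) : Prop :=
  forall (K : fieldType) (c : {rmorphism k -> K}) (w : W (@Algebra k K c)),
    exists (U : scheme k) (j : nat_trans U W),
      [/\ open_immersion j, exists u, j _ u = w &
          torsor_iso (pullback_torsor j T) (trivial_torsor G U)].

Definition affine_algebraic (k : comPzRingType) (X : functor k) : Prop :=
  exists (B : algebra k) (e : nat_trans (spec B) X),
    finite_type (alg_str B) /\ is_iso e.

Definition special (k : comPzRingType) (G : group_scheme k) : Prop :=
  affine_algebraic G /\
  forall (W : scheme k) (T : torsor G W),
    is_scheme T -> zariski_locally_trivial T.

Record fibred_groupoid (k : comPzRingType) := FibredGroupoid {
  fg_ob :> scheme k -> Type;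
  fg_hom : forall S S' : scheme k, fg_ob S -> fg_ob S' -> Type;
  fg_base : forall (S S' : scheme k) (x : fg_ob S) (y : fg_ob S'),
    fg_hom x y -> nat_trans S S';
  fg_id : forall (S : scheme k) (x : fg_ob S), fg_hom x x;
  fg_comp : forall (S S' S'' : scheme k)
      (x : fg_ob S) (y : fg_ob S') (z : fg_ob S''),
    fg_hom y z -> fg_hom x y -> fg_hom x z;
  fg_base_id : forall (S : scheme k) (x : fg_ob S), fg_base (fg_id x) = nt_id S;
  fg_base_comp : forall (S S' S'' : scheme k)
      (x : fg_ob S) (y : fg_ob S') (z : fg_ob S'')
      (v : fg_hom y z) (u : fg_hom x y),
    fg_base (fg_comp v u) = nt_comp (fg_base v) (fg_base u);
  fg_idl : forall (S S' : scheme k) (x : fg_ob S) (y : fg_ob S')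
      (u : fg_hom x y), fg_comp (fg_id y) u = u;
  fg_idr : forall (S S' : scheme k) (x : fg_ob S) (y : fg_ob S')
      (u : fg_hom x y), fg_comp u (fg_id x) = u;
  fg_assoc : forall (S1 S2 S3 S4 : scheme k)
      (x1 : fg_ob S1) (x2 : fg_ob S2) (x3 : fg_ob S3) (x4 : fg_ob S4)
      (w : fg_hom x3 x4) (v : fg_hom x2 x3) (u : fg_hom x1 x2),
    fg_comp w (fg_comp v u) = fg_comp (fg_comp w v) u;
  fg_pullback : forall (S S' : scheme k) (f : nat_trans S S') (y : fg_ob S'),
    exists (x : fg_ob S) (u : fg_hom x y), fg_base u = f;
  fg_cartesian : forall (S S' S'' : scheme k)
      (x : fg_ob S) (y : fg_ob S') (z : fg_ob S'')
      (v : fg_hom y z) (w : fg_hom x z) (f : nat_trans S S'),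
    fg_base w = nt_comp (fg_base v) f ->
    exists! u : fg_hom x y, fg_base u = f /\ fg_comp v u = w }.

Definition fg_iso (k : comPzRingType) (X : fibred_groupoid k) (S : scheme k)
    (x y : X S) : Prop :=
  exists (u : fg_hom x y) (v : fg_hom y x),
    [/\ fg_base u = nt_id S, fg_base v = nt_id S,
        fg_comp v u = fg_id x & fg_comp u v = fg_id y].

(* 1-morphisms from a scheme U to X: functors over schemes from the slice
   category of U to X. *)
Record one_morphism (k : comPzRingType) (U : scheme k) (X : fibred_groupoid k) :=
    OneMorphism {
  om_ob : forall S : scheme k, nat_trans S U -> X S;
  om_hom : forall (S S' : scheme k) (s : nat_trans S U) (s' : nat_trans S' U)
      (h : nat_trans S S'), nt_comp s' h = s -> fg_hom (om_ob s) (om_ob s');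
  om_base : forall (S S' : scheme k) (s : nat_trans S U) (s' : nat_trans S' U)
      (h : nat_trans S S') (e : nt_comp s' h = s), fg_base (om_hom e) = h;
  om_id : forall (S : scheme k) (s : nat_trans S U)
      (e : nt_comp s (nt_id S) = s), om_hom e = fg_id (om_ob s);
  om_comp : forall (S S' S'' : scheme k)
      (s : nat_trans S U) (s' : nat_trans S' U) (s'' : nat_trans S'' U)
      (h : nat_trans S S') (h' : nat_trans S' S'')
      (e : nt_comp s' h = s) (e' : nt_comp s'' h' = s')
      (e'' : nt_comp s'' (nt_comp h' h) = s),
    om_hom e'' = fg_comp (om_hom e') (om_hom e) }.

Section QuotientStack.
Variables (k : comPzRingType) (G : group_scheme k) (Y : scheme k).
Variable (a : action G Y).

Record quotient_ob (S : scheme k) := QuotientOb {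
  qo_torsor :> torsor G S;
  qo_map : nat_trans qo_torsor Y;
  qo_equivariant : equivariant (tact qo_torsor) a qo_map }.

Record quotient_hom (S S' : scheme k) (x : quotient_ob S) (y : quotient_ob S') :=
    QuotientHom {
  qh_base : nat_trans S S';
  qh_map : nat_trans x y;
  qh_equivariant : equivariant (tact x) (tact y) qh_map;
  qh_proj : nt_comp (proj y) qh_map = nt_comp qh_base (proj x);
  qh_qo_map : nt_comp (qo_map y) qh_map = qo_map x }.

Lemma quotient_hom_ext (S S' : scheme k) (x : quotient_ob S)
    (y : quotient_ob S') (u v : quotient_hom x y) :
  qh_base u = qh_base v -> qh_map u = qh_map v -> u = v.
Proof.
case: u => b f p q r; case: v => b' f' p' q' r' /= eb ef; subst b' f'.
by rewrite (Prop_irrelevance p p') (Prop_irrelevance q q')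
  (Prop_irrelevance r r').
Qed.

Definition quotient_id (S : scheme k) (x : quotient_ob S) : quotient_hom x x.
Proof.
refine (@QuotientHom S S x x (nt_id S) (nt_id x) _ _ _).
- by [].
- exact: nat_trans_ext.
- exact: nat_trans_ext.
Defined.

Definition quotient_comp (S S' S'' : scheme k) (x : quotient_ob S)
    (y : quotient_ob S') (z : quotient_ob S'')
    (v : quotient_hom y z) (u : quotient_hom x y) : quotient_hom x z.
Proof.
refine (@QuotientHom S S'' x z (nt_comp (qh_base v) (qh_base u))
  (nt_comp (qh_map v) (qh_map u)) _ _ _).
- by move=> A g t; rewrite /= !qh_equivariant.
- apply: nat_trans_ext => A t /=.
  have /(congr1 (fun f => nt f (qh_map u A t))) /= -> := qh_proj v.
  by have /(congr1 (fun f => nt f t)) /= -> := qh_proj u.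
- apply: nat_trans_ext => A t /=.
  have /(congr1 (fun f => nt f (qh_map u A t))) /= -> := qh_qo_map v.
  by have /(congr1 (fun f => nt f t)) /= -> := qh_qo_map u.
Defined.

Lemma quotient_pullback (S S' : scheme k) (f : nat_trans S S')
    (y : quotient_ob S') :
  exists (x : quotient_ob S) (u : quotient_hom x y), qh_base u = f.
Proof.
pose T := pullback_torsor f y.
pose p : nat_trans T y := fibre_snd f (proj y).
have pE : equivariant (tact T) (tact y) p by [].
have mE : equivariant (tact T) a (nt_comp (qo_map y) p).
  by move=> A g t; rewrite /= qo_equivariant.
pose x := QuotientOb mE.
have e1 : nt_comp (proj y) p = nt_comp f (proj x).
  by apply: nat_trans_ext => A t /=; rewrite (svalP t).
by exists x, (@QuotientHom S S' x y f p pE e1 erefl).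
Qed.

(* Morphisms of torsors are bijective on fibres. *)
Lemma quotient_hom_fibre (S S' : scheme k) (y : quotient_ob S)
    (z : quotient_ob S') (v : quotient_hom y z) (A : algebra k)
    (s : S A) (t : z A) :
  proj z A t = qh_base v A s ->
  exists! t' : y A, proj y A t' = s /\ qh_map v A t' = t.
Proof.
have vp B (r : y B) : proj z B (qh_map v B r) = qh_base v B (proj y B r).
  by have /(congr1 (fun f => nt f r)) := qh_proj v.
have inj B (r r' : y B) : proj y B r = proj y B r' ->
    qh_map v B r = qh_map v B r' -> r = r'.
  move=> /torsor_simply_transitive [g [<- _]]; rewrite qh_equivariant => e.
  have [g0 [_ g0_uniq]] := @torsor_simply_transitive _ _ _ z B
    (qh_map v B r) (qh_map v B r) erefl.
  have <- : gs_one G B = g.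
    by rewrite -(g0_uniq g) // (g0_uniq (gs_one G B)) // act_one.
  by rewrite act_one.
move=> ts.
have [n [B [f [cov rE]]]] := torsor_locally_nonempty y s.
have lift i : exists r : y (B i),
    proj y _ r = fmap (f i) s /\ qh_map v _ r = fmap (f i) t.
  have [r re] := rE i.
  have : proj z _ (qh_map v _ r) = proj z _ (fmap (f i) t).
    by rewrite vp re !nt_nat ts.
  move=> /torsor_simply_transitive [g [gE _]].
  by exists (act (tact y) g r); rewrite proj_act qh_equivariant.
have [r rP] : {r : forall i, y (B i) & forall i,
    proj y _ (r i) = fmap (f i) s /\ qh_map v _ (r i) = fmap (f i) t}.
  exists (fun i => sval (cid (lift i))) => i; exact: svalP (cid (lift i)).
have [|t' [t'E t'_uniq]] := @torsor_sheaf _ _ _ y A n B f cov r.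
  move=> i j C g h e; apply: inj.
    by rewrite !nt_nat (rP i).1 (rP j).1 -!fmap_comp e.
  by rewrite !nt_nat (rP i).2 (rP j).2 -!fmap_comp e.
have shS : fppf_sheaf S by case: (sch_is_scheme S).
have shz : fppf_sheaf z := @torsor_sheaf _ _ _ z.
exists t'; split; last first.
  move=> t'' [p'' q'']; apply: t'_uniq => i; apply: inj.
    by rewrite nt_nat p'' (rP i).1.
  by rewrite nt_nat q'' (rP i).2.
split.
- have [|s0 [_ s0_uniq]] := shS A n B f cov (fun i => fmap (f i) s).
    by move=> i j C g h e; rewrite -!fmap_comp e.
  rewrite -(s0_uniq s) //; apply/esym/s0_uniq => i.
  by rewrite -nt_nat t'E (rP i).1.
- have [|t0 [_ t0_uniq]] := shz A n B f cov (fun i => fmap (f i) t).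
    by move=> i j C g h e; rewrite -!fmap_comp e.
  rewrite -(t0_uniq t) //; apply/esym/t0_uniq => i.
  by rewrite -nt_nat t'E (rP i).2.
Qed.

Lemma quotient_cartesian (S S' S'' : scheme k) (x : quotient_ob S)
    (y : quotient_ob S') (z : quotient_ob S'')
    (v : quotient_hom y z) (w : quotient_hom x z) (f : nat_trans S S') :
  qh_base w = nt_comp (qh_base v) f ->
  exists! u : quotient_hom x y, qh_base u = f /\ quotient_comp v u = w.
Proof.
move=> we.
have wp A (t : x A) : proj z A (qh_map w A t) = qh_base v A (f A (proj x A t)).
  by have /(congr1 (fun f => nt f t)) /= -> := qh_proj w; rewrite we.
pose m A (t : x A) : y A := sval (cid (quotient_hom_fibre (wp A t))).
have mP A (t : x A) :
    proj y A (m A t) = f A (proj x A t) /\ qh_map v A (m A t) = qh_map w A t.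
  by rewrite /m; case: cid => ? [].
have mU A (t : x A) (t' : y A) : proj y A t' = f A (proj x A t) ->
    qh_map v A t' = qh_map w A t -> m A t = t'.
  by move=> p q; rewrite /m; case: cid => ? [? U] /=; exact: U.
have m_nat (A B : algebra k) (h : alg_hom A B) (t : x A) :
    m B (fmap h t) = fmap h (m A t).
  by apply: mU; rewrite !nt_nat ?(mP A t).1 ?(mP A t).2.
pose mm := NatTrans m_nat.
have e1 : equivariant (tact x) (tact y) mm.
  move=> A g t; apply: mU.
    by rewrite !proj_act (mP A t).1.
  by rewrite !qh_equivariant (mP A t).2.
have e2 : nt_comp (proj y) mm = nt_comp f (proj x).
  by apply: nat_trans_ext => A t; exact: (mP A t).1.
have e3 : nt_comp (qo_map y) mm = qo_map x.
  apply: nat_trans_ext => A t /=.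
  have /(congr1 (fun f => nt f (m A t))) /= <- := qh_qo_map v.
  by rewrite (mP A t).2; have /(congr1 (fun f => nt f t)) := qh_qo_map w.
exists (QuotientHom e1 e2 e3); split=> [|u [ub uw]].
  split=> //; apply: quotient_hom_ext => //=.
  by apply: nat_trans_ext => A t; exact: (mP A t).2.
apply: quotient_hom_ext => //=; apply: nat_trans_ext => A t; apply: mU.
  by have /(congr1 (fun f => nt f t)) /= -> := qh_proj u; rewrite ub.
by rewrite -uw.
Qed.

(* The stack Y/G: over S, the G-torsors T -> S together with a G-equivariant
   morphism T -> Y. *)
Definition quotient_stack : fibred_groupoid k.
Proof.
refine (@FibredGroupoid k quotient_ob quotient_hom qh_base quotient_id
  quotient_comp _ _ _ _ _ quotient_pullback quotient_cartesian).
- by [].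
- by [].
- by move=> S S' x y u; apply: quotient_hom_ext; apply: nat_trans_ext.
- by move=> S S' x y u; apply: quotient_hom_ext; apply: nat_trans_ext.
- by move=> *; apply: quotient_hom_ext; apply: nat_trans_ext.
Defined.

Definition quotient_map_map (S : scheme k) (y : nat_trans S Y) :
  nat_trans (trivial_torsor G S) Y.
Proof.
refine (@NatTrans k (trivial_torsor G S) Y (fun A p => act a p.1 (y A p.2)) _).
by move=> A B h [g s]; rewrite /= nt_nat act_nat.
Defined.

Lemma quotient_map_equivariant (S : scheme k) (y : nat_trans S Y) :
  equivariant (tact (trivial_torsor G S)) a (quotient_map_map y).
Proof. by move=> A g p; rewrite /= act_mul. Qed.

(* The trivial torsor G x S -> S with (g, s) |-> g . y(s). *)
Definition quotient_map_ob (S : scheme k) (y : nat_trans S Y) : quotient_ob S :=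
  QuotientOb (quotient_map_equivariant y).

Definition quotient_map_hom_map (S S' : scheme k) (h : nat_trans S S') :
  nat_trans (trivial_torsor G S) (trivial_torsor G S').
Proof.
refine (@NatTrans k (trivial_torsor G S) (trivial_torsor G S')
  (fun A p => (p.1, h A p.2)) _).
by move=> A B u [g s]; rewrite /= nt_nat.
Defined.

Definition quotient_map_hom (S S' : scheme k) (y : nat_trans S Y)
    (y' : nat_trans S' Y) (h : nat_trans S S') (e : nt_comp y' h = y) :
  quotient_hom (quotient_map_ob y) (quotient_map_ob y').
Proof.
refine (@QuotientHom S S' (quotient_map_ob y) (quotient_map_ob y') h
  (quotient_map_hom_map h) _ _ _).
- by [].
- exact: nat_trans_ext.
- by rewrite -e; exact: nat_trans_ext.
Defined.

Definition quotient_morphism : one_morphism Y quotient_stack.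
Proof.
refine (@OneMorphism k Y quotient_stack quotient_map_ob quotient_map_hom _ _ _).
- by [].
- by move=> S s e; apply: quotient_hom_ext => //=; apply: nat_trans_ext => A [].
- by move=> *; apply: quotient_hom_ext => //=; apply: nat_trans_ext.
Defined.

End QuotientStack.

(* Subsets of possibly large types such as the type of objects of a stack.  The
   library type [set T] is convertible to this, but restricted to the universe
   of small types. *)
Definition collection (T : Type) : Type := T -> Prop.

(* The set of classes of the equivalence relation E. *)
Definition quotient_set (T : Type) (E : T -> T -> Prop) : Type :=
  {C : collection T | exists x, C = E x}.

Definition qclass (T : Type) (E : T -> T -> Prop) (x : T) : quotient_set E :=
  exist _ (E x) (ex_intro _ x erefl).

(* The set [X(k)] of isomorphism classes of objects of X over Spec k. *)
Definition iso_classes (k : comPzRingType) (X : fibred_groupoid k) : Type :=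
  quotient_set (@fg_iso k X (spec_base k)).

(* The map [f(k)] : U(k) -> [X(k)] of a 1-morphism f : U -> X. *)
Definition on_points (k : comPzRingType) (U : scheme k) (X : fibred_groupoid k)
    (f : one_morphism U X) (u : U (base_alg k)) : iso_classes X :=
  qclass (@fg_iso k X (spec_base k)) (om_ob f (point_morphism u)).

Definition same_orbit (k : comPzRingType) (G : group_scheme k) (Y : functor k)
    (a : action G Y) (y y' : Y (base_alg k)) : Prop :=
  exists g : G (base_alg k), act a g y = y'.

(* The sets of points carry no topology fixed in advance; a topology on T is
   therefore given by its family of open sets. *)
Definition opens (T : Type) : Type := collection (collection T).

Definition preim (T T' : Type) (f : T -> T') (V : collection T')
    : collection T :=
  fun x => V (f x).

Definition im (T T' : Type) (f : T -> T') (V : collection T) : collection T' :=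
  fun y => exists2 x, V x & f x = y.

Definition is_topology (T : Type) (O : opens T) : Prop :=
  [/\ O (fun=> True),
      forall V W : collection T, O V -> O W -> O (fun x => V x /\ W x) &
      forall F : collection (collection T), (forall V, F V -> O V) ->
        O (fun x => exists2 V, F V & V x)].

Definition continuous_map (T T' : Type) (O : opens T) (O' : opens T')
    (f : T -> T') : Prop :=
  forall V, O' V -> O (preim f V).

Definition open_map (T T' : Type) (O : opens T) (O' : opens T')
    (f : T -> T') : Prop :=
  forall V, O V -> O' (im f V).

Definition homeomorphism (T T' : Type) (O : opens T) (O' : opens T')
    (f : T -> T') : Prop :=
  exists g : T' -> T,
    [/\ cancel f g, cancel g f, continuous_map O O' f & continuous_map O' O g].

Definition embedding (T T' : Type) (O : opens T) (O' : opens T')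
    (f : T -> T') : Prop :=
  injective f /\ forall V, O V <-> exists2 W, O' W & V = preim f W.

Definition open_embedding (T T' : Type) (O : opens T) (O' : opens T')
    (f : T -> T') : Prop :=
  embedding O O' f /\ O' (im f (fun=> True)).

Definition quotient_opens (T : Type) (E : T -> T -> Prop) (O : opens T)
    : opens (quotient_set E) :=
  fun V => O (preim (@qclass T E) V).

#[short(type="preTopologicalComUnitRingType")]
HB.structure Definition PreTopologicalComUnitRing :=
  {R of TopologicalZmodule R & GRing.ComUnitRing R}.

Definition topologically_suitable (R : preTopologicalComUnitRingType) : Prop :=
  [/\ continuous (fun x : R * R => x.1 * x.2),
      is_local_ring R,
      open [set x : R | x \is a GRing.unit] &
      {within [set x : R | x \is a GRing.unit], continuous (@GRing.inv R)}].

Definition is_fibre_product (k : comPzRingType) (P Y Z S : functor k)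
    (p : nat_trans P Y) (q : nat_trans P Z)
    (f : nat_trans Y S) (g : nat_trans Z S) : Prop :=
  nt_comp f p = nt_comp g q /\
  forall A (y : Y A) (z : Z A), f A y = g A z ->
    exists! t : P A, p A t = y /\ q A t = z.

(* tau is the family of topologies on the sets Y(R), for Y locally of finite
   type over R; its values at other functors are irrelevant. *)
Record is_conrad_topology (R : preTopologicalComUnitRingType)
    (tau : forall Y : functor R, opens (Y (base_alg R))) : Prop :=
    IsConradTopology {
  conrad_topology : forall Y : scheme R, locally_finite_type Y ->
    is_topology (tau Y);
  conrad_functorial : forall (Y Z : scheme R) (f : nat_trans Y Z),
    locally_finite_type Y -> locally_finite_type Z ->
    continuous_map (tau Y) (tau Z) (@nt _ _ _ f (base_alg R));
  conrad_fibre_product : forall (P Y Z S : scheme R)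
      (p : nat_trans P Y) (q : nat_trans P Z)
      (f : nat_trans Y S) (g : nat_trans Z S),
    locally_finite_type P -> locally_finite_type Y ->
    locally_finite_type Z -> locally_finite_type S ->
    is_fibre_product p q f g ->
    forall W : collection (P (base_alg R)), tau P W <->
      forall t, W t -> exists V V',
        [/\ tau Y V, tau Z V', V (p _ t), V' (q _ t) &
            forall t', V (p _ t') -> V' (q _ t') -> W t'];
  conrad_closed_immersion : forall (Z Y : scheme R) (j : nat_trans Z Y),
    locally_finite_type Z -> locally_finite_type Y -> closed_immersion j ->
    embedding (tau Z) (tau Y) (@nt _ _ _ j (base_alg R));
  conrad_open_immersion : forall (U Y : scheme R) (j : nat_trans U Y),
    locally_finite_type U -> locally_finite_type Y -> open_immersion j ->
    open_embedding (tau U) (tau Y) (@nt _ _ _ j (base_alg R));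
  conrad_affine_line : forall V : set R, tau (affine_line R) V <-> open V }.

(* The finest topology on [X(R)] making [f(R)] continuous for all 1-morphisms
   f : U -> X from schemes U locally of finite type. *)
Definition stack_topology (R : preTopologicalComUnitRingType)
    (tau : forall Y : functor R, opens (Y (base_alg R)))
    (X : fibred_groupoid R) : opens (iso_classes X) :=
  fun V => forall (U : scheme R) (f : one_morphism U X),
    locally_finite_type U -> tau U (preim (on_points f) V).
Arguments stack_topology {R} tau X.

(* Main.v *)
(* A k-point of Y/G is a G-torsor T over Spec k with an equivariant map T -> Y,
   and a k-point t of T identifies it with the image of the point of Y below t.
   So everything reduces to finding k-points, or local sections, of torsors.

   Since G is special, torsors that are schemes are Zariski locally trivial; that
   T is a scheme is faithfully flat descent for affine morphisms.  If T becomes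
   Spec H_i over a covering A -> B_i, then T = Spec C for the ring C of compatible
   families of functions c_i in H_i, because C (x)_A B_j = H_j by flatness.

   Over the local ring R, an R-point of a scheme lies in any open subscheme
   containing its closed point.  This gives surjectivity.  For openness, a map
   f : U -> Y/G lifts to phi : U' -> Y on an open neighbourhood U' of a given
   R-point, and on U'(R) the preimage of pi(V) is the preimage under phi of the
   union of the translates of V by G(R). *)

(* Tensor products enter the definitions only through universal properties, so a concrete one is
   built and flatness is reduced to it. The obstacle is that [special] speaks only of torsors that
   are schemes, while the torsors of Y/G are mere fppf sheaves. A point t_i of T over B_i identifies
   T there with G x Spec B_i, so H_i is the coordinate ring of G tensored with B_i. That C (x)_A B_j
   maps isomorphically to H_j rests on writing C as the kernel of a linear map between finite
   products, which flat base change preserves; the inverse sends y in H_j to the family of its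
   pullbacks to all H_i (x)_A B_j. Descent is carried out over affine bases, so a torsor over U is
   first restricted to an affine chart. The open subscheme furnished by local triviality is an
   arbitrary scheme; it is shrunk to a principal open of the chart, which is visibly of finite type,
   since the topology on points is controlled only for schemes locally of finite type. *)
From HB Require Import structures.
From mathcomp Require Import all_boot all_algebra.
From mathcomp Require Import boolp classical_sets topology tvs.
Require Import Defs.

Set Implicit Arguments.
Unset Strict Implicit.
Unset Printing Implicit Defensive.

Import GRing.Theory.

Local Open Scope ring_scope.

(** * Tensor products and flatness *)

(* The type quotient_set of the statement lives in a universe above the one of
   rings, so it cannot carry algebraic structures. *)
Section Classes.
Variables (T : Type) (E : T -> T -> Prop).

Definition classes : Type := {C : T -> Prop | exists x, C = E x}.

Definition to_class (x : T) : classes := exist _ (E x) (ex_intro _ x erefl).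

Definition class_repr (C : classes) : T := sval (cid (svalP C)).

Lemma class_reprK (C : classes) : to_class (class_repr C) = C.
Proof.
case: C => S hS; rewrite /class_repr /to_class; case: cid => x /= e.
by apply: eq_exist; rewrite -e.
Qed.

Hypotheses (Exx : forall x, E x x) (Esym : forall x y, E x y -> E y x)
  (Etrans : forall x y z, E x y -> E y z -> E x z).

Lemma to_class_eq x y : E x y -> to_class x = to_class y.
Proof.
move=> xy; apply: eq_exist; apply: funext => z; apply/propext.
by split; [apply: Etrans; apply: Esym|apply: Etrans].
Qed.

Lemma to_class_inj x y : to_class x = to_class y -> E x y.
Proof. by move=> /(congr1 sval) /= ->. Qed.

Lemma class_repr_rel x : E (class_repr (to_class x)) x.
Proof. by apply: to_class_inj; rewrite class_reprK. Qed.
End Classes.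

(** A predicate on bare functions: maps lifted from tensor products and pushouts are not packaged as
    morphisms, and their targets are often plain abelian groups. *)
Definition additive_map (U V : zmodType) (h : U -> V) : Prop :=
  {morph h : x y / x + y}.

Section AdditiveMap.
Variables (U V : zmodType) (h : U -> V).
Hypothesis hD : additive_map h.

Lemma additive_map0 : h 0 = 0.
Proof. by apply: (addrI (h 0)); rewrite -hD !addr0. Qed.

Lemma additive_mapN x : h (- x) = - h x.
Proof. by apply: (addrI (h x)); rewrite -hD !subrr additive_map0. Qed.

Lemma additive_mapB x y : h (x - y) = h x - h y.
Proof. by rewrite hD additive_mapN. Qed.

Lemma additive_map_sum (I : Type) (r : seq I) (P : pred I) (F : I -> U) :
  h (\sum_(i <- r | P i) F i) = \sum_(i <- r | P i) h (F i).
Proof. exact: (big_morph h hD additive_map0). Qed.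

Lemma additive_map_inj : (forall x, h x = 0 -> x = 0) -> injective h.
Proof.
move=> h0 x y e; apply/eqP; rewrite -subr_eq0; apply/eqP/h0.
by rewrite additive_mapB e subrr.
Qed.
End AdditiveMap.

Record submodule (A : comPzRingType) (M : lmodType A) := Submodule {
  submod_mem :> M -> Prop;
  submod0 : submod_mem 0;
  submodD : forall x y, submod_mem x -> submod_mem y -> submod_mem (x + y);
  submodZ : forall a x, submod_mem x -> submod_mem (a *: x) }.

Section QuotientModule.
Variables (A : comPzRingType) (M : lmodType A) (S : submodule M).

Definition submod_rel (x y : M) : Prop := S (x - y).

Lemma submodN x : S x -> S (- x).
Proof. by rewrite -scaleN1r; exact: submodZ. Qed.

Lemma submod_rel_refl x : submod_rel x x.
Proof. by rewrite /submod_rel subrr; exact: submod0. Qed.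

Lemma submod_rel_sym x y : submod_rel x y -> submod_rel y x.
Proof. by move=> /submodN; rewrite opprB. Qed.

Lemma submod_rel_trans x y z :
  submod_rel x y -> submod_rel y z -> submod_rel x z.
Proof. by move=> /submodD /[apply]; rewrite addrA subrK. Qed.

Definition quot_module : Type := classes submod_rel.
Definition quot_proj (x : M) : quot_module := to_class submod_rel x.

HB.instance Definition _ := gen_eqMixin quot_module.
HB.instance Definition _ := gen_choiceMixin quot_module.

Lemma quot_proj_eq x y : S (x - y) -> quot_proj x = quot_proj y.
Proof.
apply: to_class_eq; [exact: submod_rel_sym|exact: submod_rel_trans].
Qed.

Lemma quot_proj_inj x y : quot_proj x = quot_proj y -> S (x - y).
Proof. by apply: to_class_inj; exact: submod_rel_refl. Qed.

Lemma quot_projP (c : quot_module) : exists x, c = quot_proj x.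
Proof. by exists (class_repr c); rewrite /quot_proj class_reprK. Qed.

Let repr x : S (class_repr (quot_proj x) - x).
Proof. exact/(class_repr_rel submod_rel_refl). Qed.

Let add (c d : quot_module) := quot_proj (class_repr c + class_repr d).
Let opp (c : quot_module) := quot_proj (- class_repr c).
Let scale a (c : quot_module) := quot_proj (a *: class_repr c).

Let addE x y : add (quot_proj x) (quot_proj y) = quot_proj (x + y).
Proof.
by apply: quot_proj_eq; rewrite opprD addrACA; apply: submodD; exact: repr.
Qed.

Let oppE x : opp (quot_proj x) = quot_proj (- x).
Proof. by apply: quot_proj_eq; rewrite -opprD; exact/submodN/repr. Qed.

Let scaleE a x : scale a (quot_proj x) = quot_proj (a *: x).
Proof. by apply: quot_proj_eq; rewrite -scalerBr; exact/submodZ/repr. Qed.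

Let addA : associative add.
Proof.
move=> c d e; have [x ->] := quot_projP c; have [y ->] := quot_projP d.
by have [z ->] := quot_projP e; rewrite !addE addrA.
Qed.

Let addC : commutative add.
Proof.
move=> c d; have [x ->] := quot_projP c; have [y ->] := quot_projP d.
by rewrite !addE addrC.
Qed.

Let add0 : left_id (quot_proj 0) add.
Proof. by move=> c; have [x ->] := quot_projP c; rewrite addE add0r. Qed.

Let addN : left_inverse (quot_proj 0) opp add.
Proof. by move=> c; have [x ->] := quot_projP c; rewrite oppE addE addNr. Qed.

HB.instance Definition _ := GRing.isZmodule.Build quot_module addA addC add0 addN.

Let scaleA a b c : scale a (scale b c) = scale (a * b) c.
Proof. by have [x ->] := quot_projP c; rewrite !scaleE scalerA. Qed.

Let scale1 : left_id 1 scale.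
Proof. by move=> c; have [x ->] := quot_projP c; rewrite scaleE scale1r. Qed.

Let scaleDr : right_distributive scale +%R.
Proof.
move=> a c d; have [x ->] := quot_projP c; have [y ->] := quot_projP d.
by rewrite [X in scale _ X]addE !scaleE [RHS]addE scalerDr.
Qed.

Let scaleDl c : {morph scale^~ c : a b / a + b}.
Proof.
by move=> a b; have [x ->] := quot_projP c; rewrite !scaleE [RHS]addE scalerDl.
Qed.

HB.instance Definition _ := GRing.Zmodule_isLmodule.Build A quot_module
  scaleA scale1 scaleDr scaleDl.

Lemma quot_proj_linear : linear quot_proj.
Proof.
move=> a x y; have -> : a *: quot_proj x = quot_proj (a *: x) by exact: scaleE.
by rewrite [RHS]addE.
Qed.

HB.instance Definition _ := GRing.isLinear.Build A M quot_module _ quot_proj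
  quot_proj_linear.

Lemma quot_proj_eq0 x : quot_proj x = 0 <-> S x.
Proof.
split=> [/quot_proj_inj|xS]; first by rewrite subr0.
by apply: quot_proj_eq; rewrite subr0.
Qed.

Section Factor.
Variables (V : zmodType) (f : M -> V).
Hypotheses (fD : additive_map f) (fS : forall x, S x -> f x = 0).

Definition quot_factor (c : quot_module) : V := f (class_repr c).

Lemma quot_factorE x : quot_factor (quot_proj x) = f x.
Proof.
by apply/eqP; rewrite -subr_eq0 -(additive_mapB fD); apply/eqP/fS/repr.
Qed.
End Factor.
End QuotientModule.

(** Values lie in an abelian group rather than an [A]-module: lifts are taken into rings and fields
    on which no [A]-module structure is declared. Linearity, where wanted, is recovered on pure
    tensors. *)
Definition balanced (A B : comPzRingType) (f : {rmorphism A -> B})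
    (M : lmodType A) (Q : zmodType) (s : M -> B -> Q) : Prop :=
  [/\ forall m m' b, s (m + m') b = s m b + s m' b,
      forall m b b', s m (b + b') = s m b + s m b' &
      forall a m b, s (a *: m) b = s m (f a * b)].

(** * Construction of the tensor product *)

Section Tensor.
Variables (A B : comPzRingType) (f : {rmorphism A -> B}) (M : lmodType A).

Definition pair_sum (Q : zmodType) (s : M -> B -> Q) (L : seq (M * B)) : Q :=
  \sum_(p <- L) s p.1 p.2.

(* Quantifying over all balanced maps makes the universal property of the
   quotient immediate. *)
Definition tensor_rel (L L' : seq (M * B)) : Prop :=
  forall (Q : zmodType) (s : M -> B -> Q), balanced f s ->
    pair_sum s L = pair_sum s L'.

Lemma tensor_rel_refl L : tensor_rel L L. Proof. by []. Qed.

Lemma tensor_rel_sym L L' : tensor_rel L L' -> tensor_rel L' L.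
Proof. by move=> e Q s sb; rewrite e. Qed.

Lemma tensor_rel_trans L1 L2 L3 :
  tensor_rel L1 L2 -> tensor_rel L2 L3 -> tensor_rel L1 L3.
Proof. by move=> e e' Q s sb; rewrite e // e'. Qed.

Definition tensor : Type := classes tensor_rel.

HB.instance Definition _ := gen_eqMixin tensor.
HB.instance Definition _ := gen_choiceMixin tensor.

Let cl (L : seq (M * B)) : tensor := to_class tensor_rel L.

Let cl_eq L L' : tensor_rel L L' -> cl L = cl L'.
Proof.
by apply: to_class_eq; [exact: tensor_rel_sym|exact: tensor_rel_trans].
Qed.

Let repr L : tensor_rel (class_repr (cl L)) L.
Proof. exact: (class_repr_rel tensor_rel_refl). Qed.

Let clP c : exists L, c = cl L.
Proof. by exists (class_repr c); rewrite /cl class_reprK. Qed.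

Let add (c d : tensor) := cl (class_repr c ++ class_repr d).
Let opp (c : tensor) := cl [seq (- p.1, p.2) | p <- class_repr c].
Let scale a (c : tensor) := cl [seq (a *: p.1, p.2) | p <- class_repr c].

Let sum_cat (Q : zmodType) (s : M -> B -> Q) L L' :
  pair_sum s (L ++ L') = pair_sum s L + pair_sum s L'.
Proof. exact: big_cat. Qed.

Let sum_opp (Q : zmodType) (s : M -> B -> Q) L : balanced f s ->
  pair_sum s [seq (- p.1, p.2) | p <- L] = - pair_sum s L.
Proof.
case=> sDl _ _; rewrite /pair_sum big_map -sumrN; apply: eq_bigr => p _ /=.
by have /additive_mapN -> : additive_map (s^~ p.2) by move=> x y; exact: sDl.
Qed.

(** Holds by commutativity of [A]. It makes scalar multiplication of formal sums independent of the
    representative. *)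
Lemma balanced_scale (Q : zmodType) (s : M -> B -> Q) a :
  balanced f s -> balanced f (fun m => s (a *: m)).
Proof.
case=> sDl sDr sZ; split=> [m m' b|m b b'|a' m b].
- by rewrite scalerDr sDl.
- by rewrite sDr.
- by rewrite scalerA mulrC -scalerA sZ.
Qed.

Let addE L L' : add (cl L) (cl L') = cl (L ++ L').
Proof. by apply: cl_eq => Q s sb; rewrite !sum_cat !repr. Qed.

Let oppE L : opp (cl L) = cl [seq (- p.1, p.2) | p <- L].
Proof. by apply: cl_eq => Q s sb; rewrite !sum_opp // repr. Qed.

Let scaleE a L : scale a (cl L) = cl [seq (a *: p.1, p.2) | p <- L].
Proof.
apply: cl_eq => Q s sb; rewrite /pair_sum !big_map /=.
exact: (repr L (balanced_scale a sb)).
Qed.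

Let addA : associative add.
Proof.
move=> c d e; have [x ->] := clP c; have [y ->] := clP d.
by have [z ->] := clP e; rewrite !addE catA.
Qed.

Let addC : commutative add.
Proof.
move=> c d; have [x ->] := clP c; have [y ->] := clP d.
by rewrite !addE; apply: cl_eq => Q s sb; rewrite !sum_cat addrC.
Qed.

Let add0 : left_id (cl [::]) add.
Proof. by move=> c; have [x ->] := clP c; rewrite addE. Qed.

Let addN : left_inverse (cl [::]) opp add.
Proof.
move=> c; have [x ->] := clP c; rewrite oppE addE.
by apply: cl_eq => Q s sb; rewrite sum_cat sum_opp // addNr /pair_sum big_nil.
Qed.

HB.instance Definition _ := GRing.isZmodule.Build tensor addA addC add0 addN.

Let scaleA a b c : scale a (scale b c) = scale (a * b) c.
Proof.
have [x ->] := clP c; rewrite !scaleE -map_comp; congr cl.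
by apply: eq_map => p /=; rewrite scalerA.
Qed.

Let scale1 : left_id 1 scale.
Proof.
move=> c; have [x ->] := clP c; rewrite scaleE; congr cl.
by rewrite -[RHS]map_id; apply: eq_map => -[m b] /=; rewrite scale1r.
Qed.

Let scaleDr : right_distributive scale +%R.
Proof.
move=> a c d; have [x ->] := clP c; have [y ->] := clP d.
by rewrite [X in scale _ X]addE !scaleE [RHS]addE map_cat.
Qed.

Let scaleDl c : {morph scale^~ c : a b / a + b}.
Proof.
move=> a b; have [x ->] := clP c; rewrite !scaleE [RHS]addE.
apply: cl_eq => Q s sb; rewrite sum_cat /pair_sum !big_map -big_split /=.
by case: sb => sDl _ _; apply: eq_bigr => p _; rewrite scalerDl sDl.
Qed.

HB.instance Definition _ := GRing.Zmodule_isLmodule.Build A tensor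
  scaleA scale1 scaleDr scaleDl.

Definition tens (m : M) (b : B) : tensor := cl [:: (m, b)].

Lemma tens_balanced : balanced f tens.
Proof.
split=> [m m' b|m b b'|a m b]; rewrite /tens.
- rewrite [RHS]addE; apply: cl_eq => Q s [sDl _ _].
  by rewrite /pair_sum /= !big_cons !big_nil !addr0 sDl.
- rewrite [RHS]addE; apply: cl_eq => Q s [_ sDr _].
  by rewrite /pair_sum /= !big_cons !big_nil !addr0 sDr.
- apply: cl_eq => Q s [_ _ sZ].
  by rewrite /pair_sum /= !big_cons !big_nil !addr0 sZ.
Qed.

Lemma tensDl m m' b : tens (m + m') b = tens m b + tens m' b.
Proof. by case: tens_balanced. Qed.

Lemma tensDr m b b' : tens m (b + b') = tens m b + tens m b'.
Proof. by case: tens_balanced. Qed.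

Lemma tensZ a m b : tens (a *: m) b = tens m (f a * b).
Proof. by case: tens_balanced. Qed.

Lemma scale_tens a m b : a *: tens m b = tens (a *: m) b.
Proof. exact: scaleE. Qed.

Lemma tens0l b : tens 0 b = 0.
Proof. by have /additive_map0 : additive_map (tens^~ b) by move=> ? ?; exact: tensDl. Qed.

Lemma tens0r m : tens m 0 = 0.
Proof. by have /additive_map0 : additive_map (tens m) by move=> ? ?; exact: tensDr. Qed.

Lemma tensor_sum (c : tensor) :
  exists L : seq (M * B), c = \sum_(p <- L) tens p.1 p.2.
Proof.
have [L ->] := clP c; exists L; elim: L => [|[m b] L IH].
  by rewrite big_nil.
by rewrite big_cons -IH [RHS]addE.
Qed.

Lemma tensor_ind (P : tensor -> Prop) :
  P 0 -> (forall m b, P (tens m b)) ->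
  (forall x y, P x -> P y -> P (x + y)) -> forall x, P x.
Proof.
move=> P0 Pt PD x; have [L ->] := tensor_sum x.
by elim: L => [|p L IH]; rewrite ?big_nil // big_cons; apply: PD.
Qed.

Lemma tensor_additive_eq (Q : zmodType) (h h' : tensor -> Q) :
  additive_map h -> additive_map h' ->
  (forall m b, h (tens m b) = h' (tens m b)) -> forall x, h x = h' x.
Proof.
move=> hD hD' e; apply: tensor_ind => //.
- by rewrite !additive_map0.
- by move=> x y ex ey; rewrite hD hD' ex ey.
Qed.

Section Lift.
Variables (Q : zmodType) (s : M -> B -> Q).
Hypothesis sb : balanced f s.

Definition tensor_lift (c : tensor) : Q := pair_sum s (class_repr c).

Lemma tensor_lift_additive : additive_map tensor_lift.
Proof.
move=> c d; have [x ->] := clP c; have [y ->] := clP d.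
by rewrite [X in tensor_lift X]addE /tensor_lift !repr // sum_cat.
Qed.

Lemma tensor_liftE m b : tensor_lift (tens m b) = s m b.
Proof. by rewrite /tensor_lift repr // /pair_sum big_seq1. Qed.
End Lift.

Lemma balanced_bilinear (P : lmodType A) (t : M -> B -> P) :
  is_bilinear f t -> balanced f t.
Proof. by case=> tDl tDr tZ tf; split=> // a m b; rewrite tZ tf. Qed.

(** Links the constructed module to the universal property in terms of which [is_flat] is stated. *)
Lemma tensor_is_tensor_product : is_tensor_product f tens.
Proof.
split=> [|Q s sbil].
  split=> *; rewrite ?scale_tens ?tensDl ?tensDr //.
  by rewrite tensZ.
have sb := balanced_bilinear sbil.
have lD := tensor_lift_additive sb.
exists (tensor_lift s); split=> [|h [hl hE]].
  split=> [a x y|m b]; last exact: tensor_liftE.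
  rewrite lD; congr (_ + _); move: x; apply: tensor_additive_eq.
  - by move=> x x'; rewrite scalerDr lD.
  - by move=> x x'; rewrite lD scalerDr.
  - by move=> m b; rewrite scale_tens !tensor_liftE //; case: sbil.
apply: funext; apply: tensor_additive_eq => //.
  by move=> x y; rewrite -[x]scale1r hl !scale1r.
by move=> m b; rewrite hE tensor_liftE.
Qed.
End Tensor.
Arguments tens {A B} f {M} m b.
Arguments tensor_lift {A B} f {M Q} s c.

Section TensorMap.
Variables (A B : comPzRingType) (f : {rmorphism A -> B}).

Lemma tensor_map_balanced (M N : lmodType A) (u : {linear M -> N}) :
  balanced f (fun m b => tens f (u m) b).
Proof.
split=> [m m' b|m b b'|a m b].
- by rewrite linearD tensDl.
- by rewrite tensDr.
- by rewrite linearZ tensZ.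
Qed.

Definition tensor_map (M N : lmodType A) (u : {linear M -> N}) :
    tensor f M -> tensor f N :=
  tensor_lift f (fun m b => tens f (u m) b).

Variables (M N : lmodType A) (u : {linear M -> N}).

Lemma tensor_mapE m b : tensor_map u (tens f m b) = tens f (u m) b.
Proof. exact: (tensor_liftE (tensor_map_balanced u)). Qed.

Lemma tensor_mapD : additive_map (tensor_map u).
Proof. exact: (tensor_lift_additive (tensor_map_balanced u)). Qed.

Lemma tensor_map_linear : linear (tensor_map u).
Proof.
move=> a x y; rewrite tensor_mapD; congr (_ + _); move: x.
apply: tensor_additive_eq => [x x'|x x'|m b].
- by rewrite scalerDr tensor_mapD.
- by rewrite tensor_mapD scalerDr.
- by rewrite scale_tens !tensor_mapE scale_tens linearZ.
Qed.

HB.instance Definition _ := GRing.isLinear.Build A (tensor f M) (tensor f N) _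
  (tensor_map u) tensor_map_linear.
End TensorMap.
Arguments tensor_map {A B} f {M N} u x.

(** * Right exactness and kernels under flat base change *)

Section Flat.
Variables (A B : comPzRingType) (f : {rmorphism A -> B}).

(** [is_flat] quantifies over all models of the two tensor products. To pass from the constructed
    ones to a model [P], it is enough that [v : P -> tensor f M] has the retraction
    [tensor_lift f t], which follows from uniqueness in the universal property of [P]. *)
Lemma is_flatP : is_flat f <->
  forall (M N : lmodType A) (u : {linear M -> N}), injective u ->
    forall x : tensor f M, tensor_map f u x = 0 -> x = 0.
Proof.
split=> [flat M N u u_inj x x0|flat M N P Q u t s h u_inj tP sP hE].
  apply: (flat M N (tensor f M) (tensor f N) u (tens f) (tens f) (tensor_map f u)
    u_inj) => //; try exact: tensor_is_tensor_product.
  - by move=> m b; exact: tensor_mapE.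
  - by rewrite [LHS]x0 linear0.
have tb := balanced_bilinear tP.1; have sb := balanced_bilinear sP.1.
have [v [[vl vE] v_uniq]] := tP.2 _ _ (tensor_is_tensor_product f M).1.
have [w [[wl wE] w_uniq]] := sP.2 _ _ (tensor_is_tensor_product f N).1.
have vD : additive_map v by move=> x y; rewrite -[x]scale1r vl !scale1r.
have wD : additive_map w by move=> x y; rewrite -[x]scale1r wl !scale1r.
have vK : cancel v (tensor_lift f t).
  have [g [_ g_uniq]] := tP.2 _ _ tP.1.
  have e1 : g = id by apply: g_uniq; split.
  have [l [ll lU]] := (tensor_is_tensor_product f M).2 _ _ tP.1.
  have le : l = tensor_lift f t.
    apply: funext; apply: tensor_additive_eq => [y y'|y y'|m b].
    - by rewrite -[y]scale1r ll.1 !scale1r.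
    - exact: (tensor_lift_additive tb).
    - by rewrite ll.2 tensor_liftE.
  have e2 : g = tensor_lift f t \o v.
    apply: g_uniq; split=> [a y y'|m b] /=; last by rewrite vE tensor_liftE.
    by rewrite -le vl ll.1.
  by move=> x; rewrite -[LHS]/((tensor_lift f t \o v) x) -e2 e1.
apply: additive_map_inj => [x y|x hx]; first by rewrite linearD.
have hv : forall y, w (h (tensor_lift f t y)) = tensor_map f u y.
  apply: tensor_additive_eq => [y y'|y y'|m b].
  - by rewrite (tensor_lift_additive tb) linearD wD.
  - exact: tensor_mapD.
  - by rewrite tensor_liftE // hE wE tensor_mapE.
rewrite -(vK x) (flat _ _ _ u_inj (v x)) ?(additive_map0 (tensor_lift_additive tb)) //.
by rewrite -hv vK hx (additive_map0 wD).
Qed.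

(** The image of S (x) B in M (x) B, described by generators because [S] is a predicate and not a
    module type. *)
Definition tensor_span (M : lmodType A) (S : submodule M) (x : tensor f M) : Prop :=
  exists L : seq (M * B),
    (forall p, p \in L -> S p.1) /\ x = \sum_(p <- L) tens f p.1 p.2.

(** Right exactness. Sending the class of [m] and [b] to the class of m (x) b modulo the span [K] is
    well defined, so the projection onto the quotient by [K] factors through (M/S) (x) B, and
    whatever dies there lies in [K]. *)
Lemma quot_tensor_exact (M : lmodType A) (S : submodule M) (x : tensor f M) :
  tensor_map f (quot_proj S) x = 0 -> tensor_span S x.
Proof.
have K0 : tensor_span S 0 by exists [::]; rewrite big_nil.
have KD y y' : tensor_span S y -> tensor_span S y' -> tensor_span S (y + y').
  move=> [L [LS ->]] [L' [LS' ->]]; exists (L ++ L'); rewrite big_cat.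
  by split=> // p; rewrite mem_cat => /orP[/LS|/LS'].
have KZ a y : tensor_span S y -> tensor_span S (a *: y).
  move=> [L [LS ->]]; exists [seq (a *: p.1, p.2) | p <- L]; split.
    by move=> _ /mapP[p pL ->]; exact/submodZ/LS.
  rewrite big_map scaler_sumr; apply: eq_bigr => p _.
  by rewrite scale_tens.
pose K := Submodule K0 KD KZ.
pose s (c : quot_module S) (b : B) := quot_factor (fun m => quot_proj K (tens f m b)) c.
have sE m b : s (quot_proj S m) b = quot_proj K (tens f m b).
  rewrite /s quot_factorE // => [y y'|y yS]; first by rewrite tensDl linearD.
  apply/quot_proj_eq0; exists [:: (y, b)]; rewrite big_seq1; split=> // p.
  by rewrite inE => /eqP ->.
have sb : balanced f s.
  split=> [c d b|c b b'|a c b].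
  - have [m ->] := quot_projP c; have [m' ->] := quot_projP d.
    by rewrite -linearD !sE tensDl linearD.
  - by have [m ->] := quot_projP c; rewrite !sE tensDr linearD.
  - have [m ->] := quot_projP c.
    by rewrite -linearZ !sE tensZ.
have e : forall y, tensor_lift f s (tensor_map f (quot_proj S) y) = quot_proj K y.
  apply: tensor_additive_eq => [y y'|y y'|m b].
  - by rewrite tensor_mapD (tensor_lift_additive sb).
  - by rewrite linearD.
  - by rewrite tensor_mapE (tensor_liftE sb) sE.
move=> x0; apply/(quot_proj_eq0 K).
by rewrite -e x0 (additive_map0 (tensor_lift_additive sb)).
Qed.

Definition ker_submod (M N : lmodType A) (d : {linear M -> N}) : submodule M.
Proof.
apply: (@Submodule _ _ (fun x => d x = 0)).
- exact: linear0.
- by move=> x y; rewrite linearD => -> ->; rewrite addr0.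
- by move=> a x; rewrite linearZ => /= ->; rewrite scaler0.
Defined.

Section KerFactor.
Variables (M N : lmodType A) (d : {linear M -> N}).

Definition ker_factor : quot_module (ker_submod d) -> N := quot_factor d.

Lemma ker_factorE x : ker_factor (quot_proj _ x) = d x.
Proof. by rewrite /ker_factor quot_factorE // => y y'; rewrite linearD. Qed.

Lemma ker_factor_linear : linear ker_factor.
Proof.
move=> a c c'; have [m ->] := quot_projP c; have [m' ->] := quot_projP c'.
by rewrite -linearP !ker_factorE linearP.
Qed.

HB.instance Definition _ := GRing.isLinear.Build A (quot_module (ker_submod d)) N _
  ker_factor ker_factor_linear.

Lemma ker_factor_inj : injective ker_factor.
Proof.
apply: additive_map_inj => [x y|c]; first by rewrite linearD.
by have [m ->] := quot_projP c; rewrite ker_factorE => ?; exact/quot_proj_eq0.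
Qed.
End KerFactor.
Arguments ker_factor {M N} d c.

(** Flatness is applied to the injection of M / ker d into [N], not to the inclusion of the kernel:
    [x] then dies in (M / ker d) (x) B, and right exactness writes it with elements of the
    kernel. *)
Lemma flat_kernel (M N : lmodType A) (d : {linear M -> N}) (x : tensor f M) :
  is_flat f -> tensor_map f d x = 0 -> tensor_span (ker_submod d) x.
Proof.
move=> /is_flatP flat x0; apply: quot_tensor_exact.
apply: (flat _ _ (ker_factor d) (@ker_factor_inj _ _ d)).
rewrite -[RHS]x0; move: (x); apply: tensor_additive_eq => [y y'|y y'|m b].
- by rewrite !tensor_mapD.
- exact: tensor_mapD.
- by rewrite !tensor_mapE [X in tens f X]ker_factorE.
Qed.
End Flat.
Arguments ker_factor {A M N} d c.

Section DProd.
Variables (A : comPzRingType) (n : nat) (M : 'I_n -> lmodType A).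

Definition dprod_module : Type := forall i, M i.

HB.instance Definition _ := gen_eqMixin dprod_module.
HB.instance Definition _ := gen_choiceMixin dprod_module.

Let add (x y : dprod_module) : dprod_module := fun i => x i + y i.
Let opp (x : dprod_module) : dprod_module := fun i => - x i.
Let zero : dprod_module := fun i => 0.
Let scale a (x : dprod_module) : dprod_module := fun i => a *: x i.

Let ext (x y : dprod_module) : (forall i, x i = y i) -> x = y.
Proof. exact: functional_extensionality_dep. Qed.

Let addA : associative add.
Proof. by move=> x y z; apply: ext => i; exact: addrA. Qed.
Let addC : commutative add.
Proof. by move=> x y; apply: ext => i; exact: addrC. Qed.
Let add0 : left_id zero add.
Proof. by move=> x; apply: ext => i; exact: add0r. Qed.
Let addN : left_inverse zero opp add.
Proof. by move=> x; apply: ext => i; exact: addNr. Qed.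

HB.instance Definition _ := GRing.isZmodule.Build dprod_module addA addC add0 addN.

Let scaleA a b x : scale a (scale b x) = scale (a * b) x.
Proof. by apply: ext => i; exact: scalerA. Qed.
Let scale1 : left_id 1 scale.
Proof. by move=> x; apply: ext => i; exact: scale1r. Qed.
Let scaleDr : right_distributive scale +%R.
Proof. by move=> a x y; apply: ext => i; exact: scalerDr. Qed.
Let scaleDl x : {morph scale^~ x : a b / a + b}.
Proof. by move=> a b; apply: ext => i; exact: scalerDl. Qed.

HB.instance Definition _ := GRing.Zmodule_isLmodule.Build A dprod_module
  scaleA scale1 scaleDr scaleDl.

Definition dprod_proj i (x : dprod_module) : M i := x i.

Lemma dprod_proj_linear i : linear (dprod_proj i). Proof. by []. Qed.

HB.instance Definition _ i := GRing.isLinear.Build A dprod_module (M i) _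
  (dprod_proj i) (dprod_proj_linear i).

Definition dprod_inj i (x : M i) : dprod_module :=
  @dfwith _ M (fun j => 0 : M j) i x.

Lemma dprod_inj_linear i : linear (@dprod_inj i).
Proof.
move=> a x y; apply: ext => j; rewrite /dprod_inj.
have -> (u v : dprod_module) : (a *: u + v) j = a *: u j + v j by [].
have [<-|ij] := eqVneq i j; first by rewrite !dfwith_in.
by rewrite !dfwith_out // scaler0 addr0.
Qed.

HB.instance Definition _ i := GRing.isLinear.Build A (M i) dprod_module _
  (@dprod_inj i) (@dprod_inj_linear i).

Lemma dprod_sumE (I : Type) (r : seq I) (F : I -> dprod_module) j :
  (\sum_(i <- r) F i) j = \sum_(i <- r) F i j.
Proof. exact: (linear_sum (dprod_proj j)). Qed.

Lemma dprod_sum (x : dprod_module) : x = \sum_i dprod_inj (x i).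
Proof.
apply: ext => j; rewrite dprod_sumE (bigD1 j) //= /dprod_inj dfwith_in.
rewrite big1 ?addr0 // => i ij; by rewrite dfwith_out.
Qed.

Variables (B : comPzRingType) (f : {rmorphism A -> B}).

(** Finiteness of the index set is what counts: the identity of the product is the finite sum of the
    maps [dprod_inj i] after [dprod_proj i], and this identity survives tensoring. *)
Lemma dprod_tensor_eq0 (x : tensor f dprod_module) :
  (forall i, tensor_map f (dprod_proj i) x = 0) -> x = 0.
Proof.
move=> x0; have -> : x = \sum_i tensor_map f (@dprod_inj i) (tensor_map f (dprod_proj i) x).
  move: x {x0}; apply: tensor_additive_eq => //.
    move=> x y; rewrite -big_split; apply: eq_bigr => i _ /=.
    by rewrite !linearD.
  move=> m b; under eq_bigr do rewrite !tensor_mapE.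
  have tD : additive_map (tens f ^~ b : dprod_module -> _) by move=> ? ?; exact: tensDl.
  by rewrite -(additive_map_sum tD) -dprod_sum.
by rewrite big1 // => i _; rewrite x0 linear0.
Qed.
End DProd.

(** * Quotient rings, residue fields and faithful flatness *)

Section QuotientRing.
Variables (A : comPzRingType) (I : submodule A^o).

Definition quot_ring : Type := quot_module I.
HB.instance Definition _ := GRing.Zmodule.on quot_ring.

Let pr (x : A) : quot_ring := quot_proj I x.

Let mul (c d : quot_ring) : quot_ring := pr (class_repr c * class_repr d).

Let mulE x y : mul (pr x) (pr y) = pr (x * y).
Proof.
apply: quot_proj_eq.
have e z : I (class_repr (pr z) - z).
  exact/(class_repr_rel (@submod_rel_refl _ _ I)).
have -> : class_repr (pr x) * class_repr (pr y) - x * y =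
    class_repr (pr x) * (class_repr (pr y) - y) + y * (class_repr (pr x) - x).
  by rewrite !mulrBr [y * x]mulrC [y * _]mulrC addrA subrK.
by apply: submodD; apply: (@submodZ _ _ I); exact: e.
Qed.

Let prP (c : quot_ring) : exists x, c = pr x. Proof. exact: (@quot_projP _ _ I c). Qed.

Let prD x y : pr x + pr y = pr (x + y).
Proof. exact/esym/(linearD (quot_proj I)). Qed.

Let mulA : associative mul.
Proof.
move=> c d e; have [x ->] := prP c; have [y ->] := prP d.
by have [z ->] := prP e; rewrite !mulE mulrA.
Qed.

Let mulC : commutative mul.
Proof.
by move=> c d; have [x ->] := prP c; have [y ->] := prP d; rewrite !mulE mulrC.
Qed.

Let mul1 : left_id (pr 1) mul.
Proof. by move=> c; have [x ->] := prP c; rewrite mulE mul1r. Qed.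

Let mulDl : left_distributive mul +%R.
Proof.
move=> c d e; have [x ->] := prP c; have [y ->] := prP d.
by have [z ->] := prP e; rewrite prD !mulE prD mulrDl.
Qed.

HB.instance Definition _ := GRing.Zmodule_isComPzRing.Build quot_ring
  mulA mulC mul1 mulDl.

Definition quot_ring_proj (x : A) : quot_ring := pr x.

Lemma quot_ring_proj_additive : zmod_morphism quot_ring_proj.
Proof. by move=> x y; exact: (linearB (quot_proj I)). Qed.

Lemma quot_ring_proj_multiplicative : monoid_morphism quot_ring_proj.
Proof. by split=> // x y; exact/esym/mulE. Qed.

HB.instance Definition _ := GRing.isZmodMorphism.Build A quot_ring
  quot_ring_proj quot_ring_proj_additive.
HB.instance Definition _ := GRing.isMonoidMorphism.Build A quot_ring
  quot_ring_proj quot_ring_proj_multiplicative.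

Lemma quot_ring_projP c : exists x, c = quot_ring_proj x.
Proof. exact: prP. Qed.

Lemma quot_ring_proj_eq0 x : quot_ring_proj x = 0 <-> I x.
Proof. exact: quot_proj_eq0. Qed.
End QuotientRing.

Definition submodule_of_ideal (A : comPzRingType) (I : set A) (hI : is_ideal I)
    : submodule A^o :=
  let: And3 I0 ID IZ := hI in @Submodule A A^o I I0 ID IZ.

Lemma mem_submodule_of_ideal (A : comPzRingType) (I : set A) (hI : is_ideal I) :
  submod_mem (submodule_of_ideal hI) = I.
Proof. by case: hI. Qed.

Local Open Scope classical_set_scope.

Lemma maximal_ideal_above (A : comPzRingType) (J : set A) :
  is_ideal J -> ~ J 1 -> exists M, is_maximal_ideal M /\ J `<=` M.
Proof.
move=> hJ J1.
(* Zorn is applied to sets whose union with [J] is a proper ideal, not to ideals containing [J]: the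
   empty chain has empty union, which satisfies the former condition but not the latter. *)
have [|M0 [[hM M1] Mmax]] :=
    @Zorn_bigcup A (fun X => is_ideal (X `|` J) /\ ~ (X `|` J) 1).
  move=> F FP Ftot; split; last first.
    case=> [[X FX X1]|//].
    by case: (FP X FX) => _; apply; left.
  have [J0 JD JZ] := hJ.
  have inU X x : F X -> (X `|` J) x -> (\bigcup_(X in F) X `|` J) x.
    by move=> FX [Xx|Jx]; [left; exists X|right].
  have two x y : (\bigcup_(X in F) X `|` J) x -> (\bigcup_(X in F) X `|` J) y ->
      (J x /\ J y) \/ exists X, [/\ F X, (X `|` J) x & (X `|` J) y].
    move=> [[X FX Xx]|Jx] [[X' FX' Xy]|Jy].
    - have [XX'|X'X] := Ftot X X' FX FX'.
        by right; exists X'; split=> //; left=> //; exact: XX'.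
      by right; exists X; split=> //; left=> //; exact: X'X.
    - by right; exists X; split=> //; [left|right].
    - by right; exists X'; split=> //; [right|left].
    - by left.
  split.
  - by right.
  - move=> x y Ux Uy; have [[Jx Jy]|[X [FX Xx Xy]]] := two x y Ux Uy.
      by right; exact: JD.
    by apply: (inU X) => //; have [[_ XD _] _] := FP X FX; exact: XD.
  - move=> a x Ux; have [[Jx _]|[X [FX Xx _]]] := two x x Ux Ux.
      by right; exact: JZ.
    by apply: (inU X) => //; have [[_ _ XZ] _] := FP X FX; exact: XZ.
exists (M0 `|` J); split; last by move=> x; right.
split=> // J' hJ' MJ' J'1.
have eJ' : J' `|` J = J' by apply/setUidPl => x Jx; apply: MJ'; right.
apply/seteqP; split=> // x J'x; left.
apply: contrapT => M0x; apply: (Mmax J'); last by rewrite eJ'.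
by split=> [y M0y|J'M0]; [apply: MJ'; left|exact/M0x/J'M0].
Qed.

Section ResidueField.
Variables (A : comPzRingType) (M : set A) (hM : is_maximal_ideal M).

Let idM : is_ideal M. Proof. by case: hM. Qed.

Definition residue_field : Type := quot_ring (submodule_of_ideal idM).
HB.instance Definition _ := GRing.ComPzRing.on residue_field.

Let pr (x : A) : residue_field := quot_ring_proj (submodule_of_ideal idM) x.

Let pr_eq0 x : pr x = 0 <-> M x.
Proof.
have := quot_ring_proj_eq0 (submodule_of_ideal idM) x.
by rewrite mem_submodule_of_ideal.
Qed.

Let one_neq0 : (1 : residue_field) != 0.
Proof. by apply/eqP => /(pr_eq0 1); case: hM. Qed.

HB.instance Definition _ := GRing.PzSemiRing_isNonZero.Build residue_field one_neq0.

Lemma maximal_ideal_inverse x : ~ M x -> exists y, M (y * x - 1).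
Proof.
have [M0 MD MZ] := idM; case: hM => _ M1 Mmax Mx.
pose J : set A := [set z | exists a m, M m /\ z = a * x + m].
have hJ : is_ideal J.
  split.
  - by exists 0, 0; rewrite mul0r addr0.
  - move=> _ _ [a [m [Mm ->]]] [a' [m' [Mm' ->]]]; exists (a + a'), (m + m').
    by split; [exact: MD|rewrite mulrDl addrACA].
  - move=> b _ [a [m [Mm ->]]]; exists (b * a), (b * m).
    by split; [exact: MZ|rewrite mulrDr mulrA].
have [|J1] := pselect (J 1).
  move=> [a [m [Mm e]]]; exists a.
  by rewrite e opprD addrA subrr add0r -mulN1r; exact: MZ.
suff JM : J = M by case: Mx; rewrite -JM; exists 1, 0; rewrite mul1r addr0.
apply: Mmax => // m Mm; exists 0, m; by rewrite mul0r add0r.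
Qed.

Let inv_ex (c : residue_field) :
  exists d, (c != 0 -> d * c = 1) /\ (c = 0 -> d = 0).
Proof.
have [x ->] := quot_ring_projP c.
have [e|e] := eqVneq (pr x) 0; first by exists 0; split=> // /negP[]; exact/eqP.
have [|y My] := @maximal_ideal_inverse x; first by move=> /pr_eq0/eqP; exact/negP.
exists (pr y); split=> [_|e']; last by rewrite /pr e' eqxx in e.
apply/eqP; rewrite -subr_eq0; apply/eqP.
have -> : pr y * quot_ring_proj _ x - 1 = pr (y * x - 1).
  by rewrite /pr rmorphB rmorphM rmorph1.
exact/pr_eq0.
Qed.

Let inv (c : residue_field) : residue_field := sval (cid (inv_ex c)).

Let mulVf x : x != 0 -> inv x * x = 1.
Proof. by move=> x0; rewrite /inv; case: cid => y /= [->]. Qed.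

Let inv0 : inv 0 = 0. Proof. by rewrite /inv; case: cid => y /= [_ ->]. Qed.

HB.instance Definition _ := GRing.ComNzRing_isField.Build residue_field mulVf inv0.

Lemma maximal_ideal_field :
  exists (K : fieldType) (x : {rmorphism A -> K}), forall a, x a = 0 <-> M a.
Proof. by exists residue_field, (quot_ring_proj (submodule_of_ideal idM)). Qed.
End ResidueField.

Local Close Scope classical_set_scope.

Definition jointly_surjective (A : comPzRingType) (n : nat)
    (B : 'I_n -> comPzRingType) (f : forall i, {rmorphism A -> B i}) : Prop :=
  forall (K : fieldType) (x : {rmorphism A -> K}),
    exists (i : 'I_n) (L : fieldType) (e : {rmorphism K -> L})
           (y : {rmorphism B i -> L}), forall a, y (f i a) = e (x a).

Section FaithfullyFlat.
Variables (A : comPzRingType) (n : nat) (B : 'I_n -> comPzRingType).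
Variable f : forall i, {rmorphism A -> B i}.
Hypotheses (flat : forall i, is_flat (f i)) (surj : jointly_surjective f).

(** If [m] is nonzero, its annihilator lies in a maximal ideal, whose residue field maps to a field
    [L] that also receives some [B i]. By flatness (A / ann m) (x) B_i injects into M (x) B_i, so 1
    (x) 1 vanishes in it; but the pairing [s'] with values in [L] sends it to 1. *)
Lemma faithfully_flat_eq0 (M : lmodType A) (m : M) :
  (forall i, tens (f i) m 1 = 0) -> m = 0.
Proof.
move=> m0.
have dl : linear (fun a : A^o => a *: m).
  by move=> a b c; rewrite scalerDl scalerA.
pose dm := GRing.isLinear.Build A A^o M _ _ dl.
pose d : {linear A^o -> M} := HB.pack (fun a : A^o => a *: m) dm.
have idd : is_ideal (fun a : A => a *: m = 0).
  split=> [|x y xm ym|a x xm]; first by rewrite scale0r.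
    by rewrite scalerDl xm ym addr0.
  by rewrite -scalerA xm scaler0.
rewrite -(scale1r m); apply: contrapT => m1.
have [N [hN annN]] := maximal_ideal_above idd m1.
have [K [x xE]] := maximal_ideal_field hN.
have [i [L [e [y ye]]]] := surj x.
pose s (a : A^o) (b : B i) : L := e (x a) * y b.
have sE c b : s c b = s (class_repr (quot_proj (ker_submod d) c)) b.
  rewrite /s; congr (e _ * _); apply/eqP; rewrite -subr_eq0 -rmorphB.
  apply/eqP/xE/annN.
  exact/(submod_rel_sym (class_repr_rel (@submod_rel_refl _ _ (ker_submod d)) c)).
pose s' (c : quot_module (ker_submod d)) (b : B i) : L := s (class_repr c) b.
have sb : balanced (f i) s'.
  split=> [c c' b|c b b'|a c b].
  - have [u ->] := quot_projP c; have [v ->] := quot_projP c'.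
    by rewrite -linearD /s' -!sE /s !rmorphD mulrDl.
  - by rewrite /s' /s rmorphD mulrDr.
  - have [u ->] := quot_projP c.
    rewrite -linearZ /s' -!sE /s !rmorphM ye mulrCA mulrA //.
have q0 : tens (f i) (quot_proj (ker_submod d) 1) 1 = 0.
  have /is_flatP fl := @flat i.
  apply: (fl _ _ (ker_factor d) (@ker_factor_inj _ _ _ d)).
  rewrite tensor_mapE [X in tens _ X]ker_factorE /=.
  by rewrite scale1r m0.
have /eqP : s' (quot_proj (ker_submod d) 1) 1 = 0.
  by rewrite -(tensor_liftE sb) q0 (additive_map0 (tensor_lift_additive sb)).
by rewrite /s' -sE /s !rmorph1 mulr1 oner_eq0.
Qed.
End FaithfullyFlat.

(* D as an A-module through g. *)
Definition restr (A D : comPzRingType) (g : {rmorphism A -> D}) : Type := D.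

Section Restr.
Variables (A D : comPzRingType) (g : {rmorphism A -> D}).
HB.instance Definition _ := GRing.ComPzRing.on (restr g).

Let scale (a : A) (d : restr g) : restr g := g a * d.
Let scaleA a b d : scale a (scale b d) = scale (a * b) d.
Proof. by rewrite /scale rmorphM mulrA. Qed.
Let scale1 : left_id 1 scale.
Proof. by move=> d; rewrite /scale rmorph1 mul1r. Qed.
Let scaleDr : right_distributive scale +%R.
Proof. by move=> a x y; rewrite /scale mulrDr. Qed.
Let scaleDl d : {morph scale^~ d : a b / a + b}.
Proof. by move=> a b; rewrite /scale rmorphD mulrDl. Qed.

HB.instance Definition _ := GRing.Zmodule_isLmodule.Build A (restr g)
  scaleA scale1 scaleDr scaleDl.

Lemma restr_scaleE (a : A) (d : restr g) : a *: d = g a * d. Proof. by []. Qed.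
End Restr.

(** * The ring structure on a tensor product of algebras *)

Section TensorRing.
Variables (A B D : comPzRingType) (f : {rmorphism A -> B}) (g : {rmorphism A -> D}).

Definition tensor_ring : Type := tensor f (restr g).
HB.instance Definition _ := GRing.Zmodule.on tensor_ring.

Let T := tensor f (restr g).
Let t (d : restr g) (b : B) : T := tens f d b.

(** The product is extended from pure tensors in two stages: [inner] lifts it in the left factor
    with a fixed pure tensor on the right, and [mul] then lifts in the right factor. *)
Let inner (d' : restr g) (b' : B) : T -> T :=
  tensor_lift f (fun (d : restr g) b => t (d * d' : restr g) (b * b')).

Let inner_balanced d' b' :
  balanced f (fun (d : restr g) b => t (d * d' : restr g) (b * b')).
Proof.
split=> [m m' b|m b1 b2|a m b]; rewrite /t.
- by rewrite mulrDl tensDl.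
- by rewrite mulrDl tensDr.
- by rewrite -mulrA -tensZ restr_scaleE -mulrA.
Qed.

Let innerD d' b' : additive_map (inner d' b').
Proof. exact: (tensor_lift_additive (inner_balanced d' b')). Qed.

Let innerE d' b' d b : inner d' b' (t d b) = t (d * d' : restr g) (b * b').
Proof. exact: (tensor_liftE (inner_balanced d' b')). Qed.

Let mul (x y : T) : T := tensor_lift f (fun (d' : restr g) b' => inner d' b' x) y.

Let outer_balanced x : balanced f (fun (d' : restr g) b' => inner d' b' x).
Proof.
split=> [m m' b|m b1 b2|a m b]; move: x; apply: tensor_additive_eq.
all: try by [exact: innerD|move=> x y; rewrite !innerD addrACA].
- by move=> d c; rewrite -/(t d c) !innerE mulrDr; exact: tensDl.
- by move=> d c; rewrite -/(t d c) !innerE mulrDr; exact: tensDr.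
- move=> d c; rewrite -/(t d c) !innerE.
  have -> : d * (a *: m) = a *: (d * m) by rewrite !restr_scaleE mulrCA.
  by rewrite /t tensZ [f a * _]mulrCA.
Qed.

Let mulE d b d' b' : mul (t d b) (t d' b') = t (d * d' : restr g) (b * b').
Proof. by rewrite /mul (tensor_liftE (outer_balanced _)) innerE. Qed.

Let mulDr x : additive_map (mul x).
Proof. exact: (tensor_lift_additive (outer_balanced x)). Qed.

Let mulDl : left_distributive mul +%R.
Proof.
move=> x y z; move: z; apply: tensor_additive_eq => [u v|u v|d b].
- exact: mulDr.
- by rewrite !mulDr addrACA.
- by rewrite /mul !(tensor_liftE (outer_balanced _)) innerD.
Qed.

Let mulC : commutative mul.
Proof.
move=> x y; move: x; apply: tensor_additive_eq => [u v|u v|d b].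
- exact: mulDl.
- exact: mulDr.
move: y; apply: tensor_additive_eq => [u v|u v|d' b'].
- exact: mulDr.
- exact: mulDl.
by rewrite -!/(t _ _) !mulE mulrC [b * _]mulrC.
Qed.

Let mulA : associative mul.
Proof.
move=> x y z; move: z; apply: tensor_additive_eq => [u v|u v|d b].
- by rewrite !mulDr.
- exact: mulDr.
move: y; apply: tensor_additive_eq => [u v|u v|d' b'].
- by rewrite mulDl mulDr.
- by rewrite mulDr mulDl.
move: x; apply: tensor_additive_eq => [u v|u v|d'' b''].
- exact: mulDl.
- by rewrite !mulDl.
by rewrite -!/(t _ _) !mulE !mulrA.
Qed.

Let mul1 : left_id (t 1 1) mul.
Proof.
apply: tensor_additive_eq => [u v|u v|d b].
- exact: mulDr.
- by [].
by rewrite -!/(t _ _) mulE !mul1r.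
Qed.

HB.instance Definition _ := GRing.Zmodule_isComPzRing.Build tensor_ring
  mulA mulC mul1 mulDl.

Definition rtens (d : D) (b : B) : tensor_ring := t d b.

Lemma rtensM d b d' b' : rtens d b * rtens d' b' = rtens (d * d') (b * b').
Proof. exact: mulE. Qed.

Definition tensor_inl (d : D) : tensor_ring := rtens d 1.
Definition tensor_inr (b : B) : tensor_ring := rtens 1 b.

Lemma tensor_inl_additive : zmod_morphism tensor_inl.
Proof.
move=> x y; apply: (@additive_mapB _ _ (tensor_inl : restr g -> tensor_ring)).
by move=> u v; exact: tensDl.
Qed.
Lemma tensor_inl_multiplicative : monoid_morphism tensor_inl.
Proof. by split=> // x y; rewrite rtensM mulr1. Qed.
Lemma tensor_inr_additive : zmod_morphism tensor_inr.
Proof.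
by move=> x y; apply: additive_mapB => u v; exact: tensDr.
Qed.
Lemma tensor_inr_multiplicative : monoid_morphism tensor_inr.
Proof. by split=> // x y; rewrite rtensM mulr1. Qed.

HB.instance Definition _ := GRing.isZmodMorphism.Build D tensor_ring
  tensor_inl tensor_inl_additive.
HB.instance Definition _ := GRing.isMonoidMorphism.Build D tensor_ring
  tensor_inl tensor_inl_multiplicative.
HB.instance Definition _ := GRing.isZmodMorphism.Build B tensor_ring
  tensor_inr tensor_inr_additive.
HB.instance Definition _ := GRing.isMonoidMorphism.Build B tensor_ring
  tensor_inr tensor_inr_multiplicative.

Lemma rtensE d b : rtens d b = tensor_inl d * tensor_inr b.
Proof. by rewrite rtensM mulr1 mul1r. Qed.
End TensorRing.

(** * Presented rings, pushouts and flat base change *)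

Inductive ring_term (D X : Type) : Type :=
| TCst of D
| TVar of X
| TAdd of ring_term D X & ring_term D X
| TOpp of ring_term D X
| TMul of ring_term D X & ring_term D X.
Arguments TCst {D X}.
Arguments TVar {D X}.

Fixpoint teval (D X : Type) (C : comPzRingType) (g : D -> C) (y : X -> C)
    (s : ring_term D X) : C :=
  match s with
  | TCst d => g d
  | TVar x => y x
  | TAdd s t => teval g y s + teval g y t
  | TOpp s => - teval g y s
  | TMul s t => teval g y s * teval g y t
  end.

Section PresentedRing.
Variables (D : comPzRingType) (X : Type).
Variable rels : ring_term D X -> ring_term D X -> Prop.

Definition satisfies_rels (C : comPzRingType) (g : {rmorphism D -> C}) (y : X -> C)
    : Prop :=
  forall s t, rels s t -> teval g y s = teval g y t.

(* Quantifying over all models makes the ring axioms and the universal property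
   immediate. *)
Definition term_rel (s t : ring_term D X) : Prop :=
  forall (C : comPzRingType) (g : {rmorphism D -> C}) (y : X -> C),
    satisfies_rels g y -> teval g y s = teval g y t.

Lemma term_rel_refl s : term_rel s s. Proof. by []. Qed.
Lemma term_rel_sym s t : term_rel s t -> term_rel t s.
Proof. by move=> e C g y m; rewrite e. Qed.
Lemma term_rel_trans s t u : term_rel s t -> term_rel t u -> term_rel s u.
Proof. by move=> e e' C g y m; rewrite e // e'. Qed.

Definition presented_ring : Type := classes term_rel.
HB.instance Definition _ := gen_eqMixin presented_ring.
HB.instance Definition _ := gen_choiceMixin presented_ring.

Let cl s : presented_ring := to_class term_rel s.

Let cl_eq s t : term_rel s t -> cl s = cl t.
Proof. by apply: to_class_eq; [exact: term_rel_sym|exact: term_rel_trans]. Qed.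

Let repr s : term_rel (class_repr (cl s)) s.
Proof. exact: (class_repr_rel term_rel_refl). Qed.

Let clP c : exists s, c = cl s.
Proof. by exists (class_repr c); rewrite /cl class_reprK. Qed.

Let add (c d : presented_ring) := cl (TAdd (class_repr c) (class_repr d)).
Let opp (c : presented_ring) := cl (TOpp (class_repr c)).
Let mul (c d : presented_ring) := cl (TMul (class_repr c) (class_repr d)).

Let addE s t : add (cl s) (cl t) = cl (TAdd s t).
Proof. by apply: cl_eq => C g y m /=; rewrite !repr. Qed.
Let oppE s : opp (cl s) = cl (TOpp s).
Proof. by apply: cl_eq => C g y m /=; rewrite !repr. Qed.
Let mulE s t : mul (cl s) (cl t) = cl (TMul s t).
Proof. by apply: cl_eq => C g y m /=; rewrite !repr. Qed.

Let addA : associative add.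
Proof.
move=> c d e; have [x ->] := clP c; have [y ->] := clP d.
have [z ->] := clP e; rewrite !addE; apply: cl_eq => C g v m /=.
exact: addrA.
Qed.
Let addC : commutative add.
Proof.
move=> c d; have [x ->] := clP c; have [y ->] := clP d.
by rewrite !addE; apply: cl_eq => C g v m /=; exact: addrC.
Qed.
Let add0 : left_id (cl (TCst 0)) add.
Proof.
move=> c; have [x ->] := clP c.
by rewrite !addE; apply: cl_eq => C g v m /=; rewrite rmorph0 add0r.
Qed.
Let addN : left_inverse (cl (TCst 0)) opp add.
Proof.
move=> c; have [x ->] := clP c; rewrite oppE addE.
by apply: cl_eq => C g v m /=; rewrite rmorph0 addNr.
Qed.

HB.instance Definition _ :=
  GRing.isZmodule.Build presented_ring addA addC add0 addN.

Let mulA : associative mul.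
Proof.
move=> c d e; have [x ->] := clP c; have [y ->] := clP d.
have [z ->] := clP e; rewrite !mulE; apply: cl_eq => C g v m /=.
exact: mulrA.
Qed.
Let mulC : commutative mul.
Proof.
move=> c d; have [x ->] := clP c; have [y ->] := clP d.
by rewrite !mulE; apply: cl_eq => C g v m /=; exact: mulrC.
Qed.
Let mul1 : left_id (cl (TCst 1)) mul.
Proof.
move=> c; have [x ->] := clP c.
by rewrite !mulE; apply: cl_eq => C g v m /=; rewrite rmorph1 mul1r.
Qed.
Let mulDl : left_distributive mul +%R.
Proof.
move=> c d e; have [x ->] := clP c; have [y ->] := clP d.
have [z ->] := clP e; rewrite [X in mul X]addE !mulE [RHS]addE.
by apply: cl_eq => C g v m /=; exact: mulrDl.
Qed.

HB.instance Definition _ := GRing.Zmodule_isComPzRing.Build presented_ring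
  mulA mulC mul1 mulDl.

Definition pres_cst (d : D) : presented_ring := cl (TCst d).
Definition pres_var (x : X) : presented_ring := cl (TVar x).

Lemma pres_cst_additive : zmod_morphism pres_cst.
Proof.
move=> x y; apply: esym; rewrite [X in _ + X]oppE [LHS]addE.
by apply: cl_eq => C g v m /=; rewrite rmorphB.
Qed.
Lemma pres_cst_multiplicative : monoid_morphism pres_cst.
Proof.
split=> // x y; apply: esym; rewrite [LHS]mulE.
by apply: cl_eq => C g v m /=; rewrite rmorphM.
Qed.
HB.instance Definition _ := GRing.isZmodMorphism.Build D presented_ring
  pres_cst pres_cst_additive.
HB.instance Definition _ := GRing.isMonoidMorphism.Build D presented_ring
  pres_cst pres_cst_multiplicative.

Lemma teval_pres s : teval pres_cst pres_var s = cl s.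
Proof.
elim: s => [d|x|s IHs t IHt|s IHs|s IHs t IHt] //=.
- by rewrite IHs IHt [LHS]addE.
- by rewrite IHs [LHS]oppE.
- by rewrite IHs IHt [LHS]mulE.
Qed.

Lemma pres_satisfies : satisfies_rels pres_cst pres_var.
Proof.
move=> s t st; rewrite !teval_pres; apply: cl_eq => C g y m; exact: m.
Qed.

Lemma pres_ind (P : presented_ring -> Prop) :
  (forall d, P (pres_cst d)) -> (forall x, P (pres_var x)) ->
  (forall c d, P c -> P d -> P (c + d)) -> (forall c, P c -> P (- c)) ->
  (forall c d, P c -> P d -> P (c * d)) -> forall c, P c.
Proof.
move=> Pc Pv PD PN PM c; have [s ->] := clP c; rewrite -teval_pres.
by elim: s => [d|x|s IHs t IHt|s IHs|s IHs t IHt] /=; auto.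
Qed.

Lemma pres_rmorph_eq (C : comPzRingType) (h h' : {rmorphism presented_ring -> C}) :
  (forall d, h (pres_cst d) = h' (pres_cst d)) ->
  (forall x, h (pres_var x) = h' (pres_var x)) -> h = h'.
Proof.
move=> ec ev; apply: rmorph_ext; apply: pres_ind => //.
- by move=> c d ecc ed; rewrite !rmorphD ecc ed.
- by move=> c ecc; rewrite !rmorphN ecc.
- by move=> c d ecc ed; rewrite !rmorphM ecc ed.
Qed.

Section Lift.
Variables (C : comPzRingType) (g : {rmorphism D -> C}) (y : X -> C).
Hypothesis gy : satisfies_rels g y.

Let h (c : presented_ring) : C := teval g y (class_repr c).

Let hE s : h (cl s) = teval g y s. Proof. exact: repr. Qed.

Let hB : zmod_morphism h.
Proof.
move=> c d; have [s ->] := clP c; have [t ->] := clP d.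
by rewrite [X in _ + X]oppE [X in h X]addE !hE.
Qed.

Let hM : monoid_morphism h.
Proof.
split=> [|c d]; first by rewrite hE /= rmorph1.
have [s ->] := clP c; have [t ->] := clP d.
by rewrite [X in h X]mulE !hE.
Qed.

Lemma pres_lift : exists h : {rmorphism presented_ring -> C},
  (forall d, h (pres_cst d) = g d) /\ (forall x, h (pres_var x) = y x).
Proof.
pose ha := GRing.isZmodMorphism.Build _ _ h hB.
pose hm := GRing.isMonoidMorphism.Build _ _ h hM.
pose hh : {rmorphism presented_ring -> C} := HB.pack h ha hm.
by exists hh; split=> z /=; rewrite hE.
Qed.
End Lift.
End PresentedRing.

(** Finite type and finite presentation refer to some ring with the universal property of
    polynomials. After a change of base or of the number of variables such a ring must be produced;
    it is the presented ring without relations. *)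
Lemma polynomial_ring_exists (n : nat) (D : comPzRingType) :
  exists (P : comPzRingType) (c : {rmorphism D -> P}) (x : 'I_n -> P),
    is_polynomial_ring c x.
Proof.
pose rels (s t : ring_term D 'I_n) := False.
exists (presented_ring rels), (@pres_cst D _ rels), (@pres_var D _ rels).
move=> C g y; have [|h hE] := @pres_lift D _ rels C g y; first by [].
exists h; split=> // h' h'E; apply: pres_rmorph_eq => z.
  by rewrite hE.1 h'E.1.
by rewrite hE.2 h'E.2.
Qed.

Lemma polynomial_ring_rmorph_eq (n : nat) (D P C : comPzRingType)
    (c : {rmorphism D -> P}) (x : 'I_n -> P) (h h' : {rmorphism P -> C}) :
  is_polynomial_ring c x -> (forall d, h (c d) = h' (c d)) ->
  (forall i, h (x i) = h' (x i)) -> h = h'.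
Proof.
move=> px ec ex; have [u [_ uU]] := px C (h \o c) (fun i => h (x i)).
by rewrite -(uU h) // -(uU h') //; split=> z /=; rewrite ?ec ?ex.
Qed.

(** States that [E] is D (x)_A B as a module; the universal property for ring maps is derived in
    [pushout_rmorph]. It is a predicate on [E] because descent recognizes the given rings [H j] as
    base changes of the descent ring. *)
Record is_pushout (A B D E : comPzRingType) (f : {rmorphism A -> B})
    (g : {rmorphism A -> D}) (i : {rmorphism D -> E}) (j : {rmorphism B -> E})
    : Prop := IsPushout {
  pushout_comm : forall a, i (g a) = j (f a);
  pushout_lift : forall (Q : zmodType) (s : restr g -> B -> Q), balanced f s ->
    exists h : E -> Q, additive_map h /\ forall d b, h (i d * j b) = s d b;
  pushout_gen : forall e, exists L : seq (D * B),
    e = \sum_(p <- L) i p.1 * j p.2 }.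

Lemma tensor_pushout (A B D : comPzRingType) (f : {rmorphism A -> B})
    (g : {rmorphism A -> D}) :
  is_pushout f g (@tensor_inl _ _ _ f g) (@tensor_inr _ _ _ f g).
Proof.
split=> [a|Q s sb|e].
- rewrite /= /tensor_inl /tensor_inr /rtens -[f a]mulr1 -tensZ.
  by rewrite restr_scaleE mulr1.
- exists (tensor_lift f s); split; first exact: tensor_lift_additive.
  by move=> d b; rewrite -rtensE /rtens tensor_liftE.
- have [L ->] := tensor_sum e; exists L; apply: eq_bigr => p _.
  by rewrite -rtensE.
Qed.

Lemma mult_balanced (A B D E : comPzRingType) (f : {rmorphism A -> B})
    (g : {rmorphism A -> D}) (i : {rmorphism D -> E}) (j : {rmorphism B -> E}) :
  (forall a, i (g a) = j (f a)) ->
  balanced f (fun (d : restr g) b => i d * j b).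
Proof.
move=> c; split=> [d d' b|d b b'|a d b].
- by rewrite rmorphD mulrDl.
- by rewrite rmorphD mulrDr.
- by rewrite restr_scaleE !rmorphM c mulrAC mulrC mulrA [_ * j b]mulrC mulrA.
Qed.

Section Pushout.
Variables (A B D E : comPzRingType) (f : {rmorphism A -> B}).
Variables (g : {rmorphism A -> D}) (i : {rmorphism D -> E}) (j : {rmorphism B -> E}).

Lemma pushout_of_bijective (comm : forall a, i (g a) = j (f a)) :
  bijective (tensor_lift f (fun (d : restr g) b => i d * j b)) ->
  is_pushout f g i j.
Proof.
set l := tensor_lift _ _; case=> l' lK l'K.
have lD : additive_map l := tensor_lift_additive (mult_balanced comm).
have lE d b : l (tens f (d : restr g) b) = i d * j b.
  exact: (tensor_liftE (mult_balanced comm)).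
split=> // [Q s sb|e].
  exists (tensor_lift f s \o l'); split=> [x y|d b] /=.
    rewrite -{1}(l'K x) -{1}(l'K y) -lD lK.
    exact: (tensor_lift_additive sb).
  by rewrite -lE lK tensor_liftE.
have [L eL] := tensor_sum (l' e); exists L; rewrite -(l'K e) eL.
by rewrite (additive_map_sum lD); apply: eq_bigr => p _; rewrite lE.
Qed.

Hypothesis po : is_pushout f g i j.

Lemma pushout_ind (P : E -> Prop) :
  (forall d b, P (i d * j b)) ->
  (forall x y, P x -> P y -> P (x + y)) -> forall x, P x.
Proof.
move=> Pt PD x; have [L ->] := pushout_gen po x.
elim: L => [|p L IH]; last by rewrite big_cons; apply: PD.
by rewrite big_nil -(mulr0 (i 0)) -(rmorph0 j).
Qed.

Lemma pushout_additive_eq (Q : zmodType) (h h' : E -> Q) :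
  additive_map h -> additive_map h' ->
  (forall d b, h (i d * j b) = h' (i d * j b)) -> forall x, h x = h' x.
Proof.
by move=> hD hD' e; apply: pushout_ind => // x y ex ey; rewrite hD hD' ex ey.
Qed.

Lemma pushout_rmorph_eq (F : comPzRingType) (w w' : {rmorphism E -> F}) :
  (forall d, w (i d) = w' (i d)) -> (forall b, w (j b) = w' (j b)) -> w = w'.
Proof.
move=> ei ej; apply: rmorph_ext; apply: pushout_additive_eq => [x y|x y|d b].
- exact: rmorphD.
- exact: rmorphD.
- by rewrite !rmorphM ei ej.
Qed.

Lemma pushout_rmorph (F : comPzRingType) (u : {rmorphism D -> F})
    (v : {rmorphism B -> F}) : (forall a, u (g a) = v (f a)) ->
  exists w : {rmorphism E -> F}, (forall d, w (i d) = u d) /\ (forall b, w (j b) = v b).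
Proof.
move=> uv; have [h [hD hE]] := pushout_lift po (mult_balanced uv).
have hi d : h (i d) = u d by rewrite -[i d]mulr1 -(rmorph1 j) hE rmorph1 mulr1.
have hj b : h (j b) = v b by rewrite -[j b]mul1r -(rmorph1 i) hE rmorph1 mul1r.
have hB : zmod_morphism h by move=> x y; exact: additive_mapB.
have hM : monoid_morphism h.
  split; first by rewrite -(rmorph1 i) hi rmorph1.
  move=> x y; move: y; apply: pushout_additive_eq => [y y'|y y'|d' b'].
  - by rewrite mulrDr hD.
  - by rewrite hD mulrDr.
  move: x; apply: pushout_additive_eq => [y y'|y y'|d b].
  - by rewrite mulrDl hD.
  - by rewrite hD mulrDl.
  by rewrite mulrACA -!rmorphM !hE !rmorphM mulrACA.
pose ha := GRing.isZmodMorphism.Build _ _ h hB.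
pose hm := GRing.isMonoidMorphism.Build _ _ h hM.
by pose hh : {rmorphism E -> F} := HB.pack h ha hm; exists hh.
Qed.
End Pushout.

Definition restr_module (A D : comPzRingType) (g : {rmorphism A -> D})
  (M : lmodType D) : Type := M.

Section RestrModule.
Variables (A D : comPzRingType) (g : {rmorphism A -> D}) (M : lmodType D).
HB.instance Definition _ := GRing.Zmodule.on (restr_module g M).

Let scale (a : A) (d : restr_module g M) : restr_module g M := g a *: (d : M).
Let scaleA a b d : scale a (scale b d) = scale (a * b) d.
Proof. by rewrite /scale rmorphM scalerA. Qed.
Let scale1 : left_id 1 scale.
Proof. by move=> d; rewrite /scale rmorph1 scale1r. Qed.
Let scaleDr : right_distributive scale +%R.
Proof. by move=> a x y; rewrite /scale scalerDr. Qed.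
Let scaleDl d : {morph scale^~ d : a b / a + b}.
Proof. by move=> a b; rewrite /scale rmorphD scalerDl. Qed.

HB.instance Definition _ := GRing.Zmodule_isLmodule.Build A (restr_module g M)
  scaleA scale1 scaleDr scaleDl.

Lemma restr_module_scaleE (a : A) (m : M) :
  a *: (m : restr_module g M) = g a *: m.
Proof. by []. Qed.
End RestrModule.

Section FlatBaseChange.
Variables (A B D E : comPzRingType) (f : {rmorphism A -> B}).
Variables (g : {rmorphism A -> D}) (i : {rmorphism D -> E}) (j : {rmorphism B -> E}).
Hypothesis po : is_pushout f g i j.

Section Comparison.
Variable M : lmodType D.
Let M' : lmodType A := restr_module g M.

(* Both M (x)_D E and M (x)_A B are computed by m (x) (i d * j b) = (d m) (x) b. *)
Lemma base_change_tensor : exists alpha : tensor i M -> tensor f M',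
  [/\ additive_map alpha,
      forall m b, alpha (tens i m (j b)) = tens f (m : M') b &
      forall x, alpha x = 0 -> x = 0].
Proof.
have sb (m : M) : balanced f (fun (d : restr g) b => tens f (d *: m : M') b).
  split=> [d d' b|d b b'|a d b].
  - by rewrite scalerDl; exact: tensDl.
  - exact: tensDr.
  - by rewrite restr_scaleE -scalerA -tensZ restr_module_scaleE.
pose k m : E -> tensor f M' := sval (cid (pushout_lift po (sb m))).
have kD m : additive_map (k m) by rewrite /k; case: cid => ? [].
have kE m d b : k m (i d * j b) = tens f (d *: m : M') b.
  by rewrite /k; case: cid => ? [].
have kb : balanced i k.
  split=> [m m' e|m e e'|d m e].
  - move: e; apply: (pushout_additive_eq po) => [x y|x y|d b]; first exact: kD.
      by rewrite !kD addrACA.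
    by rewrite !kE scalerDr; exact: tensDl.
  - exact: kD.
  - move: e; apply: (pushout_additive_eq po) => [x y|x y|d' b]; first exact: kD.
      by rewrite mulrDr kD.
    by rewrite mulrA -rmorphM !kE scalerA mulrC.
pose al := tensor_lift i k.
have alD : additive_map al := tensor_lift_additive kb.
have alE m e : al (tens i m e) = k m e := tensor_liftE kb m e.
have bb : balanced f (fun (m : M') b => tens i (m : M) (j b)).
  split=> [m m' b|m b b'|a m b].
  - exact: tensDl.
  - by rewrite rmorphD tensDr.
  - by rewrite restr_module_scaleE tensZ (pushout_comm po) rmorphM.
have bD := tensor_lift_additive bb.
have bK : forall x, tensor_lift f (fun (m : M') b => tens i (m : M) (j b)) (al x) = x.
  apply: tensor_additive_eq => [x y|x y|m e] //; first by rewrite alD bD.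
  rewrite alE; move: e; apply: (pushout_additive_eq po) => [x y|x y|d b].
  - by rewrite kD bD.
  - exact: tensDr.
  - by rewrite kE (tensor_liftE bb) tensZ.
exists al; split=> // [m b|x x0].
  by rewrite alE -[j b]mul1r -(rmorph1 i) kE scale1r.
by rewrite -(bK x) x0 (additive_map0 bD).
Qed.
End Comparison.

(** The comparison of M (x)_D E with M (x)_A B is natural in [M], so an injection of [D]-modules is
    tested as an injection of [A]-modules tensored with [B]. *)
Lemma flat_base_change : is_flat f -> is_flat i.
Proof.
move=> /is_flatP flat; apply/is_flatP => M N u u_inj x x0.
have [al [alD alE al0]] := base_change_tensor M.
have [be [beD beE be0]] := base_change_tensor N.
have u'l : linear (u : restr_module g M -> restr_module g N).
  by move=> a m m'; rewrite !restr_module_scaleE linearP.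
pose um := GRing.isLinear.Build A (restr_module g M) (restr_module g N) _ _ u'l.
pose u' : {linear restr_module g M -> restr_module g N} :=
  HB.pack (u : restr_module g M -> restr_module g N) um.
have e : forall y, be (tensor_map i u y) = tensor_map f u' (al y).
  apply: tensor_additive_eq => [y y'|y y'|m c].
  - by rewrite tensor_mapD beD.
  - by rewrite alD tensor_mapD.
  rewrite tensor_mapE; move: c; apply: (pushout_additive_eq po) => [y y'|y y'|d b].
  - by rewrite tensDr beD.
  - by rewrite tensDr alD tensor_mapD.
  - by rewrite -!tensZ alE tensor_mapE beE -linearZ.
apply: al0; apply: (flat _ _ u') => //.
by rewrite -e x0 (additive_map0 beD).
Qed.
End FlatBaseChange.

(** * Fppf coverings *)

Lemma rmorph_factor (P B F : comPzRingType) (q : {rmorphism P -> B})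
    (w : {rmorphism P -> F}) :
  (forall b, exists p, q p = b) -> (forall p, q p = 0 -> w p = 0) ->
  exists v : {rmorphism B -> F}, forall p, v (q p) = w p.
Proof.
move=> q_surj qw; pose v b := w (sval (cid (q_surj b))).
have vE p : v (q p) = w p.
  rewrite /v; case: cid => p' /= e; apply/eqP; rewrite -subr_eq0 -rmorphB.
  by apply/eqP/qw; rewrite rmorphB e subrr.
have vB : zmod_morphism v.
  move=> b b'; have [p <-] := q_surj b; have [p' <-] := q_surj b'.
  by rewrite -rmorphB !vE rmorphB.
have vM : monoid_morphism v.
  split=> [|b b']; first by rewrite -(rmorph1 q) vE rmorph1.
  have [p <-] := q_surj b; have [p' <-] := q_surj b'.
  by rewrite -rmorphM !vE rmorphM.
pose ha := GRing.isZmodMorphism.Build _ _ v vB.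
pose hm := GRing.isMonoidMorphism.Build _ _ v vM.
by pose hh : {rmorphism B -> F} := HB.pack v ha hm; exists hh.
Qed.

(** The variables are kept and the relations are transported by [th]. That they generate the whole
    kernel of [q'] comes from the pushout property: it yields [w] from [E] to [PD] modulo the
    transported relations such that [w] after [q'] is the projection. *)
Lemma finite_presentation_base_change (A B D E : comPzRingType)
    (f : {rmorphism A -> B}) (g : {rmorphism A -> D})
    (i : {rmorphism D -> E}) (j : {rmorphism B -> E}) :
  is_pushout f g i j -> finite_presentation f -> finite_presentation i.
Proof.
move=> po [n [P [c [x [q [m [r [px qc q_surj q_ker]]]]]]]].
have [PD [cD [xD pxD]]] := polynomial_ring_exists n D.
have [th [[thc thx] _]] := px PD (cD \o g) xD.
have [q' [[q'c q'x] _]] := pxD E i (fun k => j (q (x k))).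
have q'th p : q' (th p) = j (q p).
  suff e : (q' \o th) = (j \o q) :> {rmorphism P -> E}.
    by rewrite -[LHS]/((q' \o th : {rmorphism P -> E}) p) e.
  apply: (polynomial_ring_rmorph_eq px) => [a|k] /=.
    by rewrite thc /= q'c qc (pushout_comm po).
  by rewrite thx q'x.
have q'_surj e : exists p, q' p = e.
  move: e; apply: (pushout_ind po) => [d b|_ _ [p <-] [p' <-]].
    by have [p <-] := q_surj b; exists (cD d * th p); rewrite rmorphM q'c q'th.
  by exists (p + p'); rewrite rmorphD.
exists n, PD, cD, xD, q', m, (th \o r); split=> // p; split; last first.
  move=> [a ->]; rewrite rmorph_sum big1 // => k _; rewrite rmorphM /= q'th.
  suff -> : q (r k) = 0 by rewrite rmorph0 mulr0.
  apply/q_ker; exists (fun l => (l == k)%:R); rewrite (bigD1 k) //= eqxx mul1r.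
  by rewrite big1 ?addr0 // => l /negbTE ->; rewrite mul0r.
pose I : set PD := fun p => exists a : 'I_m -> PD, p = \sum_(k < m) a k * th (r k).
have idI : is_ideal I.
  split.
  - by exists (fun=> 0); rewrite big1 // => k _; rewrite mul0r.
  - move=> _ _ [a ->] [b ->]; exists (fun k => a k + b k).
    by rewrite -big_split; apply: eq_bigr => k _; rewrite mulrDl.
  - move=> z _ [a ->]; exists (fun k => z * a k); rewrite mulr_sumr.
    by apply: eq_bigr => k _; rewrite mulrA.
pose pr := @quot_ring_proj PD (submodule_of_ideal idI).
have prE z : pr z = 0 <-> I z.
  have := quot_ring_proj_eq0 (submodule_of_ideal idI) z.
  by rewrite mem_submodule_of_ideal.
have [|v vE] := @rmorph_factor _ _ _ q (pr \o th) q_surj.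
  move=> z /q_ker [a ->] /=; apply/prE; exists (th \o a).
  by rewrite rmorph_sum; apply: eq_bigr => k _; rewrite rmorphM.
have [|w [wi wj]] := @pushout_rmorph _ _ _ _ f g i j po _ (pr \o cD) v.
  by move=> a; rewrite -qc vE /= thc.
have e : (w \o q') = pr :> {rmorphism PD -> _}.
  apply: (polynomial_ring_rmorph_eq pxD) => [d|k] /=.
    by rewrite q'c wi.
  by rewrite q'x wj vE /= thx.
move=> q'p; apply/prE; rewrite -[LHS]/((pr : {rmorphism _ -> _}) p) -e /=.
by rewrite q'p rmorph0.
Qed.

Section AlgebraPushout.
Variables (k : comPzRingType) (A B D : algebra k).
Variables (f : alg_hom A B) (g : alg_hom A D).

(** The order of the factors is that of a base change along [g]: [D], the target of the second
    argument, is the left factor, and [B] the right one. *)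
Definition tensor_alg : algebra k :=
  @Algebra k (tensor_ring f g) (@tensor_inl _ _ _ f g \o alg_str D).

Definition tensor_algl : alg_hom D tensor_alg :=
  @AlgHom k D tensor_alg (@tensor_inl _ _ _ f g) (fun=> erefl).

Lemma tensor_algr_subproof a :
  @tensor_inr _ _ _ f g (alg_str B a) = alg_str tensor_alg a.
Proof.
by rewrite -(alg_funE f) -(pushout_comm (tensor_pushout f g)) alg_funE.
Qed.

Definition tensor_algr : alg_hom B tensor_alg :=
  @AlgHom k B tensor_alg (@tensor_inr _ _ _ f g) tensor_algr_subproof.

Lemma tensor_alg_pushout : is_pushout f g tensor_algl tensor_algr.
Proof. exact: tensor_pushout. Qed.

Variables (E : algebra k) (i : alg_hom D E) (j : alg_hom B E).
Hypothesis po : is_pushout f g i j.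

Lemma pushout_alg_comm : alg_comp i g = alg_comp j f.
Proof. by apply: alg_hom_ext => a; exact: (pushout_comm po a). Qed.

Variable F : algebra k.

Lemma pushout_alg_eq (w w' : alg_hom E F) :
  alg_comp w i = alg_comp w' i -> alg_comp w j = alg_comp w' j -> w = w'.
Proof.
move=> ei ej; apply: alg_hom_ext => e.
have -> // : alg_fun w = alg_fun w'; apply: (pushout_rmorph_eq po).
  by move=> d; have /(congr1 (fun h => alg_fun h d)) := ei.
by move=> b; have /(congr1 (fun h => alg_fun h b)) := ej.
Qed.

Lemma pushout_alg_lift (u : alg_hom D F) (v : alg_hom B F) :
  alg_comp u g = alg_comp v f ->
  exists w : alg_hom E F, alg_comp w i = u /\ alg_comp w j = v.
Proof.
move=> uv; have [|w [wi wj]] := pushout_rmorph po (u := u) (v := v).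
  by move=> a; have /(congr1 (fun h => alg_fun h a)) := uv.
have wk a : w (alg_str E a) = alg_str F a by rewrite -(alg_funE i) wi alg_funE.
by exists (@AlgHom k E F w wk); split; apply: alg_hom_ext.
Qed.
End AlgebraPushout.

Lemma fppf_covering_base_change (k : comPzRingType) (A D : algebra k) (n : nat)
    (B E : 'I_n -> algebra k) (f : forall i, alg_hom A (B i)) (g : alg_hom A D)
    (p : forall i, alg_hom D (E i)) (q : forall i, alg_hom (B i) (E i)) :
  (forall i, is_pushout (f i) g (p i) (q i)) ->
  fppf_covering f -> fppf_covering p.
Proof.
move=> po [fl surj]; split=> [i|K x].
  have [fi fpi] := fl i; split; first exact: (flat_base_change (po i) fi).
  exact: (finite_presentation_base_change (po i) fpi).
have [i [L [e [y ye]]]] := surj K (x \o g).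
have [|w [wp _]] := pushout_rmorph (po i) (u := e \o x) (v := y).
  by move=> a; rewrite ye.
by exists i, L, e, w => d; rewrite wp.
Qed.

Section Covering.
Variables (k : comPzRingType) (A : algebra k) (n : nat) (B : 'I_n -> algebra k).
Variable f : forall i, alg_hom A (B i).
Hypothesis cov : fppf_covering f.

Lemma covering_tens_eq0 (M : lmodType A) (m : M) :
  (forall i, tens (f i) m 1 = 0) -> m = 0.
Proof.
apply: faithfully_flat_eq0 => [i|]; first by case: cov => fl _; case: (fl i).
by case: cov.
Qed.

Lemma covering_eq0 (a : A) : (forall i, f i a = 0) -> a = 0.
Proof.
move=> a0; apply: (@covering_tens_eq0 A^o) => i.
have -> : (a : A^o) = a *: (1 : A^o) by rewrite [RHS]mulr1.
by rewrite tensZ a0 mul0r tens0r.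
Qed.

Lemma covering_inj (a a' : A) : (forall i, f i a = f i a') -> a = a'.
Proof.
move=> e; apply/eqP; rewrite -subr_eq0; apply/eqP/covering_eq0 => i.
by rewrite rmorphB e subrr.
Qed.

(* Faithfully flat descent for elements: the class of s in (prod_i B_i) / A
   vanishes, because s (x) 1 = 1 (x) s_j after tensoring with B_j. *)
Lemma covering_glue (s : forall i, B i) :
  (forall i j, tensor_algl (f j) (f i) (s i) = tensor_algr (f j) (f i) (s j)) ->
  exists a : A, forall i, f i a = s i.
Proof.
move=> sE; pose M : lmodType A := dprod_module (fun i => restr (f i)).
pose dg (a : A) : M := fun i => f i a.
have dgl a b c : dg (a * b + c) = a *: dg b + dg c.
  by apply: functional_extensionality_dep => i; rewrite /dg rmorphD rmorphM.
have S0 : exists a, (0 : M) = dg a.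
  by exists 0; apply: functional_extensionality_dep => i; rewrite /dg rmorph0.
have dgD a b : dg (a + b) = dg a + dg b.
  by rewrite -[a]mul1r dgl scale1r mul1r.
have SD (x y : M) : (exists a, x = dg a) -> (exists a, y = dg a) ->
    exists a, x + y = dg a.
  by move=> [a ->] [b ->]; exists (a + b); rewrite dgD.
have SZ (a : A) (x : M) : (exists b, x = dg b) -> exists b, a *: x = dg b.
  move=> [b ->]; exists (a * b).
  by apply: functional_extensionality_dep => i; rewrite /dg rmorphM.
pose S : submodule M := Submodule S0 SD SZ.
have : quot_proj S (s : M) = 0.
  apply: covering_tens_eq0 => j.
  have -> : tens (f j) (quot_proj S (s : M)) 1 =
      tensor_map (f j) (quot_proj S) (tens (f j) (s : M) 1).
    by rewrite tensor_mapE.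
  have -> : tens (f j) (s : M) 1 = tens (f j) (dg 1) (s j).
    apply/eqP; rewrite -subr_eq0; apply/eqP/dprod_tensor_eq0 => i.
    rewrite (additive_mapB (@tensor_mapD _ _ (f j) _ _ _)) !tensor_mapE.
    rewrite [X in _ - tens _ X _](_ : _ = 1); last exact: rmorph1.
    apply/eqP; rewrite subr_eq0; apply/eqP.
    exact: sE.
  rewrite tensor_mapE.
  rewrite [X in tens _ X _](_ : _ = 0); first exact: tens0l.
  by apply/(quot_proj_eq0 S); exists 1.
move=> /quot_proj_eq0 [a sa]; exists a => i.
by rewrite (congr1 (fun z : M => z i) sa).
Qed.
End Covering.

(** The values of the local homomorphisms at each element of [C] are glued separately. Since [A]
    injects into the product of the [B i], the glued function is a homomorphism and is unique. *)
Lemma spec_sheaf (k : comPzRingType) (C : algebra k) : fppf_sheaf (spec C).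
Proof.
move=> A n B f cov s sE.
have glue c : exists a : A, forall i, f i a = s i c.
  apply: (covering_glue cov (s := fun i => s i c)) => i j.
  have e := pushout_alg_comm (tensor_alg_pushout (f j) (f i)).
  by have /(congr1 (fun h : alg_hom C _ => h c)) := sE _ _ _ _ _ e.
pose h c := sval (cid (glue c)).
have hE c i : f i (h c) = s i c by rewrite /h; case: cid => ? /= ->.
have inj := covering_inj cov.
have hB : zmod_morphism h.
  by move=> x y; apply: inj => i; rewrite rmorphB !hE rmorphB.
have hM : monoid_morphism h.
  split=> [|x y]; apply: inj => i; first by rewrite hE !rmorph1.
  by rewrite rmorphM !hE rmorphM.
pose ha := GRing.isZmodMorphism.Build _ _ h hB.
pose hm := GRing.isMonoidMorphism.Build _ _ h hM.
pose hh : {rmorphism C -> A} := HB.pack h ha hm.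
have hk a : hh (alg_str C a) = alg_str A a.
  by apply: inj => i; rewrite [LHS]hE !alg_funE.
exists (@AlgHom k C A hh hk); split=> [i|h' h'E].
  by apply: alg_hom_ext => c; exact: hE.
apply: alg_hom_ext => c; apply: inj => i; rewrite [LHS]hE.
by rewrite -h'E.
Qed.

Lemma open_immersion_iso (k : comPzRingType) (X Y : functor k) (j : nat_trans X Y) :
  is_iso j -> open_immersion j.
Proof.
move=> iso; split=> [A|A x]; first exact/bij_inj/iso.
exists (fun=> True); split=> [//|C f]; split=> _.
  exists 1%N, (fun=> 1), (fun=> 1); split=> //.
  by rewrite big_ord1 rmorph1 mulr1.
by have [j' _ jK] := iso C; exists (j' (fmap f x)); rewrite jK.
Qed.

Lemma nt_id_iso (k : comPzRingType) (X : functor k) : is_iso (nt_id X).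
Proof. by move=> A; exists id. Qed.

Lemma spec_is_scheme (k : comPzRingType) (C : algebra k) : is_scheme (spec C).
Proof.
split; first exact: spec_sheaf.
move=> K c x; exists C, (nt_id _); split=> //; last by exists x.
exact/open_immersion_iso/nt_id_iso.
Qed.

Definition spec_scheme (k : comPzRingType) (C : algebra k) : scheme k :=
  Scheme (spec_is_scheme C).

Lemma spec_scheme_lft (k : comPzRingType) (C : algebra k) :
  finite_type (alg_str C) -> locally_finite_type (spec_scheme C).
Proof.
move=> ft K c x; exists C, (nt_id _); split=> //; last by exists x.
exact/open_immersion_iso/nt_id_iso.
Qed.

(** * Descent of affine schemes *)

Lemma bijective_of_inj_surj (S T : Type) (h : S -> T) :
  injective h -> (forall y, exists x, h x = y) -> bijective h.
Proof.
move=> h_inj h_surj; exists (fun y => sval (cid (h_surj y))) => [x|y].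
  by apply: h_inj; case: cid.
by case: cid.
Qed.

Lemma fppf_sheaf_separated (k : comPzRingType) (X : functor k) (A : algebra k)
    (n : nat) (B : 'I_n -> algebra k) (f : forall i, alg_hom A (B i)) (x y : X A) :
  fppf_sheaf X -> fppf_covering f -> (forall i, fmap (f i) x = fmap (f i) y) ->
  x = y.
Proof.
move=> sh cov xy; have [|z [_ zU]] := sh A n B f cov (fun i => fmap (f i) y).
  by move=> i j C g h e; rewrite -!fmap_comp e.
by rewrite -(zU x) // -(zU y).
Qed.

Section RestrictedMap.
Variables (k : comPzRingType) (A D1 D2 : algebra k).
Variables (g1 : alg_hom A D1) (g2 : alg_hom A D2) (u : alg_hom D1 D2).
Hypothesis ug : alg_comp u g1 = g2.

Lemma restr_map_linear : linear (u : restr g1 -> restr g2).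
Proof.
move=> a x y; rewrite rmorphD; congr (_ + _).
by rewrite !restr_scaleE rmorphM -ug.
Qed.

Definition restr_map : {linear restr g1 -> restr g2} :=
  let um := GRing.isLinear.Build A (restr g1) (restr g2) _ _ restr_map_linear in
  HB.pack (u : restr g1 -> restr g2) um.

(** The base change of [u] is at once a linear map, to which flatness applies, and an algebra map,
    which acts on points of functors. Descent moves between the two readings. *)
Lemma tensor_restr_map (B : algebra k) (f : alg_hom A B) :
  exists v : alg_hom (tensor_alg f g1) (tensor_alg f g2),
    [/\ forall x : tensor f (restr g1), tensor_map f restr_map x = v x,
        alg_comp v (tensor_algl f g1) = alg_comp (tensor_algl f g2) u &
        alg_comp v (tensor_algr f g1) = tensor_algr f g2].
Proof.
have [|v [vl vr]] := pushout_alg_lift (tensor_alg_pushout f g1)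
    (u := alg_comp (tensor_algl f g2) u) (v := tensor_algr f g2).
  by rewrite spec_comp ug (pushout_alg_comm (tensor_alg_pushout f g2)).
exists v; split=> //; apply: tensor_additive_eq => [x y|x y|d b].
- exact: tensor_mapD.
- exact: (rmorphD v).
rewrite tensor_mapE.
have -> : tens f (d : restr g1) b = tensor_algl f g1 d * tensor_algr f g1 b.
  by rewrite -rtensE.
have -> : tens f (restr_map d) b = tensor_algl f g2 (u d) * tensor_algr f g2 b.
  by rewrite -rtensE.
have vld : v (tensor_algl f g1 d) = tensor_algl f g2 (u d).
  by have /(congr1 (fun h => alg_fun h d)) := vl.
have vrb : v (tensor_algr f g1 b) = tensor_algr f g2 b.
  by have /(congr1 (fun h => alg_fun h b)) := vr.
by rewrite rmorphM vld vrb.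
Qed.
End RestrictedMap.

Section AffineDescent.
Variables (k : comPzRingType) (A : algebra k) (T : functor k).
Variables (q : nat_trans T (spec A)) (n : nat) (B : 'I_n -> algebra k).
Variables (f : forall i, alg_hom A (B i)).
Hypotheses (shT : fppf_sheaf T) (cov : fppf_covering f).
(* (H i, iota i, tau i) represents the restriction of T to Spec (B i). *)
Variables (H : 'I_n -> algebra k) (iota : forall i, alg_hom (B i) (H i)).
Variables (tau : forall i, T (H i)).
Hypothesis q_tau : forall i, q _ (tau i) = alg_comp (iota i) (f i).
Hypothesis tau_lift : forall i (E : algebra k) (g : alg_hom (B i) E) (t : T E),
  q _ t = alg_comp g (f i) ->
  exists eta : alg_hom (H i) E, alg_comp eta (iota i) = g /\ fmap eta (tau i) = t.
Hypothesis tau_uniq : forall i (E : algebra k) (eta eta' : alg_hom (H i) E),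
  alg_comp eta (iota i) = alg_comp eta' (iota i) ->
  fmap eta (tau i) = fmap eta' (tau i) -> eta = eta'.

Lemma descent_base i (E : algebra k) (eta : alg_hom (H i) E) :
  q _ (fmap eta (tau i)) = alg_comp eta (alg_comp (iota i) (f i)).
Proof. by rewrite nt_nat q_tau. Qed.

(* Global functions on T: families of functions on its restrictions that agree
   at points of T. *)
Definition descent_cond (c : forall i, H i) : Prop :=
  forall i j (E : algebra k) (eta : alg_hom (H i) E) (theta : alg_hom (H j) E),
    fmap eta (tau i) = fmap theta (tau j) -> eta (c i) = theta (c j).

Definition descent_ring : Type := {c : forall i, H i | descent_cond c}.
HB.instance Definition _ := gen_eqMixin descent_ring.
HB.instance Definition _ := gen_choiceMixin descent_ring.

Let ext (c d : descent_ring) : (forall i, sval c i = sval d i) -> c = d.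
Proof.
case: c d => [c hc] [d hd] /= e; apply: eq_exist.
exact: functional_extensionality_dep.
Qed.

Let zero : descent_ring.
Proof. by exists (fun=> 0) => i j E eta theta _; rewrite !rmorph0. Defined.
Let one : descent_ring.
Proof. by exists (fun=> 1) => i j E eta theta _; rewrite !rmorph1. Defined.
Let add (c d : descent_ring) : descent_ring.
Proof.
exists (fun i => sval c i + sval d i) => i j E eta theta e; rewrite !rmorphD.
by rewrite (svalP c _ _ _ _ _ e) (svalP d _ _ _ _ _ e).
Defined.
Let opp (c : descent_ring) : descent_ring.
Proof.
exists (fun i => - sval c i) => i j E eta theta e; rewrite !rmorphN.
by rewrite (svalP c _ _ _ _ _ e).
Defined.
Let mul (c d : descent_ring) : descent_ring.
Proof.
exists (fun i => sval c i * sval d i) => i j E eta theta e; rewrite !rmorphM.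
by rewrite (svalP c _ _ _ _ _ e) (svalP d _ _ _ _ _ e).
Defined.

Let addA : associative add.
Proof. by move=> c d e; apply: ext => i; exact: addrA. Qed.
Let addC : commutative add.
Proof. by move=> c d; apply: ext => i; exact: addrC. Qed.
Let add0 : left_id zero add.
Proof. by move=> c; apply: ext => i; exact: add0r. Qed.
Let addN : left_inverse zero opp add.
Proof. by move=> c; apply: ext => i; exact: addNr. Qed.
HB.instance Definition _ :=
  GRing.isZmodule.Build descent_ring addA addC add0 addN.

Let mulA : associative mul.
Proof. by move=> c d e; apply: ext => i; exact: mulrA. Qed.
Let mulC : commutative mul.
Proof. by move=> c d; apply: ext => i; exact: mulrC. Qed.
Let mul1 : left_id one mul.
Proof. by move=> c; apply: ext => i; exact: mul1r. Qed.
Let mulDl : left_distributive mul +%R.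
Proof. by move=> c d e; apply: ext => i; exact: mulrDl. Qed.
HB.instance Definition _ := GRing.Zmodule_isComPzRing.Build descent_ring
  mulA mulC mul1 mulDl.

Definition descent_str (a : A) : descent_ring.
Proof.
exists (fun i => iota i (f i a)) => i j E eta theta e.
have := congr1 (fun h : alg_hom A E => h a) (descent_base eta).
by rewrite e descent_base /= => <-.
Defined.

Lemma descent_str_additive : zmod_morphism descent_str.
Proof. by move=> a b; apply: ext => i; rewrite /= !rmorphB. Qed.
Lemma descent_str_multiplicative : monoid_morphism descent_str.
Proof. by split=> [|a b]; apply: ext => i; rewrite /= ?rmorph1 ?rmorphM. Qed.
HB.instance Definition _ := GRing.isZmodMorphism.Build A descent_ring
  descent_str descent_str_additive.
HB.instance Definition _ := GRing.isMonoidMorphism.Build A descent_ring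
  descent_str descent_str_multiplicative.

Definition descent_proj i (c : descent_ring) : H i := sval c i.
Lemma descent_proj_additive i : zmod_morphism (descent_proj i).
Proof. by []. Qed.
Lemma descent_proj_multiplicative i : monoid_morphism (descent_proj i).
Proof. by []. Qed.
HB.instance Definition _ i := GRing.isZmodMorphism.Build descent_ring (H i)
  (descent_proj i) (descent_proj_additive i).
HB.instance Definition _ i := GRing.isMonoidMorphism.Build descent_ring (H i)
  (descent_proj i) (descent_proj_multiplicative i).

Definition descent_alg : algebra k :=
  @Algebra k descent_ring (descent_str \o alg_str A).

Definition sigma : alg_hom A descent_alg :=
  @AlgHom k A descent_alg descent_str (fun=> erefl).

Lemma descent_pr_subproof i a :
  descent_proj i (alg_str descent_alg a) = alg_str (H i) a.
Proof. by rewrite /= /descent_proj /= !alg_funE. Qed.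

Definition descent_pr i : alg_hom descent_alg (H i) :=
  @AlgHom k descent_alg (H i) (descent_proj i) (descent_pr_subproof i).

Lemma descent_pr_sigma i : alg_comp (descent_pr i) sigma = alg_comp (iota i) (f i).
Proof. exact: alg_hom_ext. Qed.

Let u i : alg_hom A (H i) := alg_comp (iota i) (f i).
Let E i j : algebra k := tensor_alg (f j) (u i).
Let L i j : alg_hom (H i) (E i j) := tensor_algl (f j) (u i).
Let R i j : alg_hom (B j) (E i j) := tensor_algr (f j) (u i).

Let LR i j : alg_comp (L i j) (u i) = alg_comp (R i j) (f j).
Proof. exact: (pushout_alg_comm (tensor_alg_pushout (f j) (u i))). Qed.

(* The two descriptions of T over H i (x)_A B j. *)
Let eta_ex i j : exists eta : alg_hom (H j) (E i j),
  alg_comp eta (iota j) = R i j /\ fmap eta (tau j) = fmap (L i j) (tau i).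
Proof. by apply: tau_lift; rewrite descent_base LR. Qed.

Let eta i j : alg_hom (H j) (E i j) := sval (cid (eta_ex i j)).
Let eta_iota i j : alg_comp (eta i j) (iota j) = R i j.
Proof. by rewrite /eta; case: cid => ? []. Qed.
Let eta_tau i j : fmap (eta i j) (tau j) = fmap (L i j) (tau i).
Proof. by rewrite /eta; case: cid => ? []. Qed.

Let M : lmodType A := dprod_module (fun i => restr (u i)).

Let emb (c : restr sigma) : M := fun i => sval c i.
Let emb_linear : linear emb.
Proof. by move=> a x y; apply: functional_extensionality_dep. Qed.
Let embl : {linear restr sigma -> M} :=
  let em := GRing.isLinear.Build A (restr sigma) M _ _ emb_linear in HB.pack emb em.

Section At.
Variable j : 'I_n.

Let psi : tensor (f j) (restr sigma) -> H j :=
  tensor_lift (f j) (fun (c : restr sigma) b => descent_pr j c * iota j b).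

Let psi_balanced :
  balanced (f j) (fun (c : restr sigma) b => descent_pr j c * iota j b).
Proof.
by apply: mult_balanced => a; have /(congr1 (fun h => alg_fun h a)) := descent_pr_sigma j.
Qed.

Let psiD : additive_map psi := tensor_lift_additive psi_balanced.
Let psiE (c : restr sigma) b : psi (tens (f j) c b) = descent_pr j c * iota j b.
Proof. exact: (tensor_liftE psi_balanced). Qed.

Let rtens_E i (x : restr (u i)) b :
  tens (f j) x b = L i j x * R i j b :> E i j.
Proof. by rewrite -rtensE. Qed.

(** The descent ring sits in the product of the [H i], so by flatness of [B j] an element of the
    source is determined by its components in H_i (x) B_j. These are the images under [eta i j] of
    its value under [psi]. *)
Let psi_inj : injective psi.
Proof.
apply: (additive_map_inj psiD) => x x0.
have /is_flatP flat : is_flat (f j) by case: cov => fl _; case: (fl j).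
apply: (flat _ _ embl).
  move=> c d e; apply: ext => i; exact: (congr1 (fun z : M => z i) e).
apply: dprod_tensor_eq0 => i.
suff e : forall y, tensor_map (f j) (dprod_proj i) (tensor_map (f j) embl y) =
    eta i j (psi y) by rewrite e x0 rmorph0.
apply: tensor_additive_eq => [y y'|y y'|c b].
- by rewrite !tensor_mapD.
- by rewrite psiD; exact: (rmorphD (eta i j)).
rewrite !tensor_mapE psiE rmorphM.
have -> : eta i j (iota j b) = R i j b.
  by have /(congr1 (fun h => alg_fun h b)) := eta_iota i j.
by rewrite (svalP c _ _ _ _ _ (eta_tau i j)) -rtens_E.
Qed.

Let uu i l : alg_hom A (E i l) := alg_comp (L i l) (u i).
Let N : lmodType A := dprod_module (fun i => dprod_module (fun l => restr (uu i l))).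

Let L_lin i l : {linear restr (u i) -> restr (uu i l)} :=
  restr_map (erefl : alg_comp (L i l) (u i) = uu i l).

Let eta_u i l : alg_comp (eta i l) (u l) = uu i l.
Proof. by rewrite -spec_comp eta_iota /uu LR. Qed.

Let eta_lin i l : {linear restr (u l) -> restr (uu i l)} := restr_map (eta_u i l).

(** The difference of the two restrictions to the overlaps. It presents the descent ring as the
    kernel of a linear map, the form that [flat_kernel] accepts. *)
Let d (c : M) : N := fun i l => L_lin i l (c i) - eta_lin i l (c l).

Let d_linear : linear d.
Proof.
move=> a x y; apply: functional_extensionality_dep => i.
apply: functional_extensionality_dep => l.
have -> : d (a *: x + y) i l = L_lin i l (a *: x i + y i) - eta_lin i l (a *: x l + y l).
  by [].
by rewrite [L_lin i l _]linearP [eta_lin i l _]linearP opprD addrACA -scalerN -scalerDr.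
Qed.
Let dl : {linear M -> N} :=
  let dm := GRing.isLinear.Build A M N _ _ d_linear in HB.pack d dm.

(** H_i (x) B_l represents the fibre product of Spec H_i and Spec H_l over [T]: any pair [h], [th]
    giving the same point of [T] factors through it by [ka]. Agreement there is thus agreement
    everywhere. *)
Let ker_descent (c : M) : d c = 0 -> descent_cond c.
Proof.
move=> c0 i l F h th e.
have [|ka [kaL kaR]] := pushout_alg_lift (tensor_alg_pushout (f l) (u i))
    (u := h) (v := alg_comp th (iota l)).
  by rewrite -descent_base e descent_base spec_comp.
have ka_eta : alg_comp ka (eta i l) = th.
  apply: tau_uniq; first by rewrite spec_comp eta_iota.
  by rewrite fmap_comp eta_tau -fmap_comp kaL.
rewrite -ka_eta -kaL /=; congr (ka _); apply/eqP; rewrite -subr_eq0; apply/eqP.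
exact: (congr1 (fun z : N => z i l) c0).
Qed.

(** A function [y] on the restriction of [T] to Spec B_j pulls back to all H_i (x) B_j. The
    resulting element [z] is killed by [d] after tensoring with [B j], so [flat_kernel] expresses it
    through the descent ring. *)
Let psi_surj y : exists x, psi x = y.
Proof.
pose z : tensor (f j) M := \sum_i tensor_map (f j) (@dprod_inj _ _ _ i) (eta i j y).
have zE i : tensor_map (f j) (dprod_proj i) z = eta i j y.
  rewrite (additive_map_sum (@tensor_mapD _ _ (f j) _ _ _)) (bigD1 i) //=.
  rewrite big1 ?addr0 => [|l li].
    move: (eta i j y : tensor (f j) (restr (u i))).
    apply: tensor_additive_eq => [x x'|x x'|m b] //.
      by rewrite !tensor_mapD.
    by rewrite !tensor_mapE [X in tens _ X _](_ : _ = m) //; exact: dfwith_in.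
  move: (eta l j y : tensor (f j) (restr (u l))).
  apply: (@tensor_additive_eq _ _ _ _ _ _ (fun=> 0)) => [x x'|x x'|m b].
  - by rewrite !tensor_mapD.
  - by rewrite addr0.
  rewrite !tensor_mapE [X in tens _ X _](_ : _ = 0) ?tens0l //.
  exact: dfwith_out.
have flat : is_flat (f j) by case: cov => fl _; case: (fl j).
have [|s [sS zs]] := @flat_kernel _ _ _ _ _ dl z flat.
  apply: dprod_tensor_eq0 => i; apply: dprod_tensor_eq0 => l.
  have [La [LaE Lal Lar]] :=
    tensor_restr_map (erefl : alg_comp (L i l) (u i) = uu i l) (f j).
  have [Th [ThE Thl Thr]] := tensor_restr_map (eta_u i l) (f j).
  suff e : forall x : tensor (f j) M,
      tensor_map (f j) (dprod_proj l) (tensor_map (f j) (dprod_proj i)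
        (tensor_map (f j) dl x)) =
      La (tensor_map (f j) (dprod_proj i) x) - Th (tensor_map (f j) (dprod_proj l) x).
    rewrite e !zE; apply/eqP; rewrite subr_eq0; apply/eqP.
    (* Both composites send [tau j] to the same point of [T] and agree on [B j], hence coincide by
       [tau_uniq]. *)
    suff /(congr1 (fun h => alg_fun h y)) : alg_comp La (eta i j) = alg_comp Th (eta l j).
      by [].
    apply: tau_uniq; first by rewrite !spec_comp !eta_iota Lar Thr.
    rewrite !fmap_comp !eta_tau -!fmap_comp Lal Thl !fmap_comp.
    by rewrite eta_tau.
  apply: tensor_additive_eq => [x x'|x x'|m b].
  - by rewrite !tensor_mapD.
  - by rewrite !tensor_mapD !rmorphD opprD addrACA.
  rewrite -LaE -ThE !tensor_mapE.
  have tD : additive_map (fun x : restr (uu i l) => tens (f j) x b).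
    by move=> x x'; exact: tensDl.
  by rewrite -(additive_mapB tD).
(* The default [0] is never reached: by [sS] the first component of every entry of [s] is in the
   kernel of [d]. *)
pose x : tensor (f j) (restr sigma) :=
  \sum_(p <- s) (if pselect (d p.1 = 0) is left e
    then tens (f j) (exist _ p.1 (ker_descent e) : restr sigma) p.2 else 0).
(* [mu] is the multiplication H_j (x) B_j -> H_j. It retracts [eta j j], and so recovers [y] from
   the component of [z] at [j]. *)
have [|mu [muL muR]] := pushout_alg_lift (tensor_alg_pushout (f j) (u j))
    (u := alg_id (H j)) (v := iota j).
  by rewrite spec_id.
have muE : mu (eta j j y) = y.
  suff /(congr1 (fun h => alg_fun h y)) : alg_comp mu (eta j j) = alg_id (H j) by [].
  apply: tau_uniq; first by rewrite spec_comp eta_iota muR spec_id.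
  by rewrite fmap_comp eta_tau -fmap_comp muL.
exists x; rewrite -[RHS]muE -zE zs.
rewrite (additive_map_sum (@tensor_mapD _ _ (f j) _ _ _)).
rewrite (big_morph mu (rmorphD mu) (rmorph0 mu)) (additive_map_sum psiD).
rewrite !big_seq; apply: eq_bigr => p ps.
case: pselect => [e|]; last by case; exact: (sS p ps).
rewrite psiE tensor_mapE rtens_E rmorphM.
have -> v : mu (R j j v) = iota j v.
  by have /(congr1 (fun h => alg_fun h v)) := muR.
congr (_ * _); have /(congr1 (fun h => alg_fun h (p.1 j))) := muL.
by move=> /= ->.
Qed.

Lemma descent_pushout : is_pushout (f j) sigma (descent_pr j) (iota j).
Proof.
apply: pushout_of_bijective.
  by move=> a; have /(congr1 (fun h => alg_fun h a)) := descent_pr_sigma j.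
exact: (bijective_of_inj_surj psi_inj psi_surj).
Qed.
End At.

Lemma descent_covering : fppf_covering descent_pr.
Proof. exact: (fppf_covering_base_change descent_pushout cov). Qed.

(** The local universal points glue. If [h] and [th] agree on the descent ring, let [th'] be the map
    out of [H j] that lies over the same map from [B j] as [th] and classifies the point given by
    [h]. It agrees with [th] on the descent ring by the descent condition, and on [B j]; these two
    generate [H j]. *)
Lemma descent_point : exists t : T descent_alg, forall i, fmap (descent_pr i) t = tau i.
Proof.
have [|t [tE _]] := shT descent_covering (s := tau); last by exists t.
move=> i j F h th e.
have [|th' [th'i th't]] := @tau_lift j F (alg_comp th (iota j)) (fmap h (tau i)).
  by rewrite descent_base -descent_pr_sigma -spec_comp e !spec_comp descent_pr_sigma.
suff <- : th' = th by rewrite th't.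
apply: (pushout_alg_eq (descent_pushout j)) => //.
rewrite -e; apply: alg_hom_ext => c; apply/esym.
exact: (svalP c _ _ _ _ _ (esym th't)).
Qed.

(** The isomorphism evaluates at the universal point [t]. It is checked over the covering D -> D
    (x)_A B_i, where [H i] represents [T]: injectivity because [H i] is the base change of the
    descent ring, surjectivity by gluing the classifying maps in the sheaf [spec descent_alg]. *)
Lemma affine_descent :
  exists (C : algebra k) (j : nat_trans (spec C) T), is_iso j.
Proof.
have [t tE] := descent_point.
have qt : q _ t = sigma.
  apply: alg_hom_ext => a; apply: ext => i.
  have /(congr1 (fun h => alg_fun h a)) : alg_comp (descent_pr i) (q _ t) = u i.
    by rewrite /u -q_tau -tE nt_nat.
  by [].
pose m (D : algebra k) (phi : alg_hom descent_alg D) : T D := fmap phi t.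
have m_nat (D F : algebra k) (h : alg_hom D F) phi :
    m F (fmap (h : alg_hom D F) (phi : spec descent_alg D)) = fmap h (m D phi).
  exact: fmap_comp.
exists descent_alg, (NatTrans m_nat) => D /=.
have covD (g : alg_hom A D) : fppf_covering (fun i => tensor_algl (f i) g).
  exact: (fppf_covering_base_change (fun i => tensor_alg_pushout (f i) g) cov).
have LRD (g : alg_hom A D) i := pushout_alg_comm (tensor_alg_pushout (f i) g).
apply: bijective_of_inj_surj => [phi phi' e|t'].
  have g_eq : alg_comp phi sigma = alg_comp phi' sigma.
    have := congr1 (@nt _ _ _ q D) e.
    by rewrite /m !nt_nat /= qt.
  apply: alg_hom_ext => c; apply: (covering_inj (covD (alg_comp phi sigma))) => i.
  set g := alg_comp phi sigma; pose Li := tensor_algl (f i) g.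
  have [|v [vl vr]] := pushout_alg_lift (descent_pushout i)
    (u := alg_comp Li phi) (v := tensor_algr (f i) g).
    by rewrite spec_comp -/g LRD.
  have [|v' [vl' vr']] := pushout_alg_lift (descent_pushout i)
    (u := alg_comp Li phi') (v := tensor_algr (f i) g).
    by rewrite spec_comp -g_eq -/g LRD.
  have ev : v = v'.
    apply: tau_uniq; first by rewrite vr vr'.
    by rewrite -tE -!fmap_comp vl vl' !fmap_comp; congr fmap.
  have /(congr1 (fun h => alg_fun h c)) : alg_comp Li phi = alg_comp Li phi'.
    by rewrite -vl -vl' ev.
  by [].
pose g := q _ t'; pose Li i := tensor_algl (f i) g.
have h_ex i : exists h : alg_hom (H i) (tensor_alg (f i) g),
    alg_comp h (iota i) = tensor_algr (f i) g /\ fmap h (tau i) = fmap (Li i) t'.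
  by apply: tau_lift; rewrite nt_nat -LRD.
pose h i := sval (cid (h_ex i)).
have h_tau i : fmap (h i) (tau i) = fmap (Li i) t' by rewrite /h; case: cid => ? [].
have [|phi [phiE _]] := spec_sheaf (covD g)
    (s := fun i => alg_comp (h i) (descent_pr i) : spec descent_alg _).
  move=> i l F v w e; apply: alg_hom_ext => c.
  apply: (svalP c i l F (alg_comp v (h i)) (alg_comp w (h l))).
  by rewrite !fmap_comp !h_tau -!fmap_comp e.
exists phi; apply: (fppf_sheaf_separated shT (covD g)) => i.
rewrite /m -fmap_comp.
have -> : alg_comp (tensor_algl (f i) g) phi = alg_comp (h i) (descent_pr i).
  exact: phiE.
by rewrite fmap_comp tE h_tau.
Qed.
End AffineDescent.

(** * Torsors, localizations and local rings *)

Lemma alg_hom_str (k : comPzRingType) (A B : algebra k) (g : alg_hom A B) :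
  alg_comp g (str_hom A) = str_hom B.
Proof. by apply: alg_hom_ext => a; exact: (alg_funE g). Qed.

Section TorsorAffine.
Variables (k : comPzRingType) (G : group_scheme k) (W : scheme k) (T : torsor G W).
Variables (H : algebra k) (e : nat_trans (spec H) G).
Variables (A : algebra k) (w : nat_trans W (spec A)).
Hypotheses (e_iso : is_iso e) (w_iso : is_iso w).

(** Over [B i] the local point [t i] trivializes [T], so [T] is represented there by B_i (x)_k H
    with [H] the coordinate ring of [G]. The universal point [tau i] is the universal element of [G]
    applied to [t i]. *)
Lemma torsor_affine : exists (C : algebra k) (j : nat_trans (spec C) T), is_iso j.
Proof.
have [w' w'K wK] := w_iso A.
have [n [B [f [cov tE]]]] := torsor_locally_nonempty T (w' (alg_id A)).
have [t tP] : {t : forall i, T (B i) |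
    forall i, proj T _ (t i) = fmap (f i) (w' (alg_id A))}.
  by exists (fun i => sval (cid (tE i))) => i; exact: svalP (cid (tE i)).
pose q := nt_comp w (proj T).
have qt i : q _ (t i) = f i.
  rewrite -[LHS]/(w _ (proj T _ (t i))) tP nt_nat wK.
  exact: alg_hom_ext.
have q_act E (g : G E) (x : T E) : q _ (act (tact T) g x) = q _ x.
  by rewrite -[LHS]/(w _ (proj T _ _)) proj_act.
pose Hi i := tensor_alg (str_hom H) (str_hom (B i)).
pose iota i : alg_hom (B i) (Hi i) := tensor_algl (str_hom H) (str_hom (B i)).
pose r i : alg_hom H (Hi i) := tensor_algr (str_hom H) (str_hom (B i)).
have po i := tensor_alg_pushout (str_hom H) (str_hom (B i)).
pose tau i : T (Hi i) := act (tact T) (e _ (r i)) (fmap (iota i) (t i)).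
have fmap_tau i E (eta : alg_hom (Hi i) E) : fmap eta (tau i) =
    act (tact T) (e _ (alg_comp eta (r i))) (fmap (alg_comp eta (iota i)) (t i)).
  by rewrite act_nat -nt_nat fmap_comp.
apply: (@affine_descent k A T q n B f (@torsor_sheaf _ _ _ T) cov Hi iota tau).
- by move=> i; rewrite q_act nt_nat qt.
- move=> i E g x qx.
  have [|gam [gamE _]] := @torsor_simply_transitive _ _ _ T E (fmap g (t i)) x.
    apply: (bij_inj (w_iso E)); change (q _ (fmap g (t i)) = q _ x).
    by rewrite nt_nat qt qx.
  have [e' _ eK] := e_iso E.
  have [|eta [etal etar]] := pushout_alg_lift (po i) (u := g) (v := e' gam).
    by rewrite !alg_hom_str.
  by exists eta; split=> //; rewrite fmap_tau etal etar eK.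
- move=> i E eta eta' el et; apply: (pushout_alg_eq (po i)) => //.
  apply: (bij_inj (e_iso E)).
  have [g [gE gU]] := @torsor_simply_transitive _ _ _ T E
    (fmap (alg_comp eta (iota i)) (t i)) (fmap eta (tau i))
    (esym (etrans (f_equal (proj T E) (fmap_tau _ _ eta)) (proj_act _ _))).
  have <- : g = e _ (alg_comp eta (r i)) by apply: gU; rewrite fmap_tau.
  by apply: gU; rewrite et fmap_tau el.
Qed.

Lemma torsor_is_scheme : is_scheme T.
Proof.
split; first exact: torsor_sheaf.
have [C [j j_iso]] := torsor_affine.
move=> K c x; exists C, j; split=> //; first exact: open_immersion_iso.
by have [j' _ jK] := j_iso (@Algebra k K c); exists (j' x); rewrite jK.
Qed.
End TorsorAffine.

Definition spec_map (k : comPzRingType) (B C : algebra k) (g : alg_hom B C) :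
    nat_trans (spec C) (spec B) :=
  @NatTrans k (spec C) (spec B) (fun A h => alg_comp h g)
    (fun A D f h => spec_comp f h g).

(** * Principal open subschemes *)

Section Localization.
Variables (k : comPzRingType) (B : algebra k) (b : B).

Definition loc_rels (s t : ring_term B unit) : Prop :=
  s = TMul (TCst b) (TVar tt) /\ t = TCst 1.

Definition loc_alg : algebra k :=
  @Algebra k (presented_ring loc_rels) (@pres_cst B unit loc_rels \o alg_str B).

Definition loc_hom : alg_hom B loc_alg :=
  @AlgHom k B loc_alg (@pres_cst B unit loc_rels) (fun=> erefl).

Definition loc_inv : loc_alg := @pres_var B unit loc_rels tt.

Lemma loc_homK : loc_hom b * loc_inv = 1.
Proof.
have := @pres_satisfies B unit loc_rels (TMul (TCst b) (TVar tt)) (TCst 1).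
by move=> /(_ (conj erefl erefl)) /= ->; exact: (rmorph1 loc_hom).
Qed.

Lemma loc_lift (C : algebra k) (h : alg_hom B C) (y : C) :
  h b * y = 1 -> exists h' : alg_hom loc_alg C, alg_comp h' loc_hom = h.
Proof.
move=> hy; have [|h' [h'E _]] := @pres_lift B unit loc_rels C h (fun=> y).
  by move=> _ _ [-> ->] /=; rewrite hy rmorph1.
have h'k a : h' (alg_str loc_alg a) = alg_str C a by rewrite h'E alg_funE.
by exists (@AlgHom k loc_alg C h' h'k); apply: alg_hom_ext.
Qed.

Lemma loc_uniq (C : algebra k) (h h' : alg_hom loc_alg C) :
  alg_comp h loc_hom = alg_comp h' loc_hom -> h = h'.
Proof.
move=> e; have eB d : h (loc_hom d) = h' (loc_hom d).
  by have /(congr1 (fun h => alg_fun h d)) := e.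
apply: alg_hom_ext => x; suff -> : alg_fun h = alg_fun h' by [].
apply: pres_rmorph_eq => [d|[]]; first exact: eB.
rewrite -/loc_inv -[LHS]mulr1 -(rmorph1 h') -loc_homK rmorphM -eB.
by rewrite mulrA [h loc_inv * _]mulrC -rmorphM loc_homK rmorph1 mul1r.
Qed.

Lemma loc_open_immersion : open_immersion (spec_map loc_hom).
Proof.
split=> [C h h'|A x]; first exact: loc_uniq.
exists (fun a => exists c, a = c * x b); split.
  split=> [|_ _ [c ->] [d ->]|a _ [c ->]].
  - by exists 0; rewrite mul0r.
  - by exists (c + d); rewrite mulrDl.
  - by exists (a * c); rewrite mulrA.
move=> C f; split=> [[u ue]|[n [a [c [aI c1]]]]].
  exists 1%N, (fun=> x b), (fun=> u loc_inv); split=> [_|].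
    by exists 1; rewrite mul1r.
  rewrite big_ord1 mulrC; have /(congr1 (fun h => alg_fun h b)) /= <- := ue.
  by rewrite -rmorphM loc_homK rmorph1.
have [d dE] : exists d : 'I_n -> A, forall i, a i = d i * x b.
  by exists (fun i => sval (cid (aI i))) => i; case: cid.
(* The certificate that the multiples of [x b] generate the unit ideal of [C] factors as f (x b)
   times this sum, which is therefore the required inverse. *)
have [|h' h'E] := @loc_lift C (alg_comp f x) (\sum_(i < n) c i * f (d i)).
  rewrite -[RHS]c1 mulr_sumr; apply: eq_bigr => i _ /=.
  by rewrite dE rmorphM mulrCA [f (x b) * _]mulrC.
by exists h'.
Qed.

Lemma loc_finite_type : finite_type (alg_str B) -> finite_type (alg_str loc_alg).
Proof.
move=> [n [P [c [x [q [px qc q_surj]]]]]].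
have [P' [c' [x' px']]] := polynomial_ring_exists n.+1 k.
(* Variable [ord0] stands for the inverse of [b], the other [n] for the generators of [B]. *)
pose y (i : 'I_n.+1) : loc_alg :=
  if unlift ord0 i is Some i' then loc_hom (q (x i')) else loc_inv.
have [q' [[q'c q'x] _]] := px' loc_alg (alg_str loc_alg) y.
have [th [[thc thx] _]] := px P' c' (fun i => x' (lift ord0 i)).
have q'th p : q' (th p) = loc_hom (q p).
  suff e : (q' \o th) = (loc_hom \o q) :> {rmorphism P -> loc_alg}.
    by rewrite -[LHS]/((q' \o th : {rmorphism P -> loc_alg}) p) e.
  apply: (polynomial_ring_rmorph_eq px) => [a|i] /=.
    by rewrite thc q'c qc.
  by rewrite thx q'x /y liftK.
exists n.+1, P', c', x', q'; split=> //.
apply: pres_ind => [d|[]|_ _ [p <-] [p' <-]|_ [p <-]|_ _ [p <-] [p' <-]].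
- by have [p <-] := q_surj d; exists (th p); rewrite q'th.
- by exists (x' ord0); rewrite q'x /y unlift_none.
- by exists (p + p'); rewrite rmorphD.
- by exists (- p); rewrite rmorphN.
- by exists (p * p'); rewrite rmorphM.
Qed.
End Localization.

(** * Residue field and points over a local ring *)

Section LocalRing.
Variables (k : comPzRingType).
Hypothesis k_local : is_local_ring k.

(** A nonunit generates a proper ideal, which lies in the unique maximal ideal, the kernel of
    [rho]. *)
Lemma local_residue_field : exists (K : fieldType) (rho : {rmorphism k -> K}),
  forall a, rho a != 0 -> exists b, a * b = 1.
Proof.
have [M [hM M_uniq]] := k_local.
have [K [rho rhoE]] := maximal_ideal_field hM.
exists K, rho => a /eqP a0; apply: contrapT => a_unit.
pose I : set k := fun x => exists b, x = a * b.
have idI : is_ideal I.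
  split=> [|_ _ [b ->] [c ->]|x _ [b ->]].
  - by exists 0; rewrite mulr0.
  - by exists (b + c); rewrite mulrDr.
  - by exists (x * b); rewrite mulrCA.
have [|N [hN IN]] := maximal_ideal_above idI.
  by move=> [b e]; apply: a_unit; exists b.
apply/a0/rhoE; rewrite (M_uniq N hN); apply: IN; exists 1.
by rewrite mulr1.
Qed.

Lemma unit_ideal_point (A : comPzRingType) (K : fieldType)
    (f : {rmorphism A -> K}) (I : set A) :
  generates_unit_ideal f I -> exists a, I a /\ f a != 0.
Proof.
move=> [n [a [b [aI e]]]]; apply: contrapT => no.
have : (1 : K) != 0 := oner_neq0 K.
rewrite -e big1 ?eqxx // => i _; have [->|fa] := eqVneq (f (a i)) 0.
  by rewrite mulr0.
by case: no; exists (a i).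
Qed.

(* An open subscheme containing the closed point of the image of Spec k contains
   the whole image. *)
Lemma local_point_open (K : fieldType) (rho : {rmorphism k -> K}) :
  (forall a, rho a != 0 -> exists b, a * b = 1) ->
  forall (U X : functor k) (j : nat_trans U X) (x : X (base_alg k)),
    open_immersion j ->
    (exists u, j _ u = fmap (str_hom (@Algebra k K rho)) x) -> exists u, j _ u = x.
Proof.
move=> rho_unit U X j x [_ /(_ _ x)[I [_ hI]]] /hI /unit_ideal_point [a [aI a0]].
have [b ab] := rho_unit a a0.
have /hI [u ue] : generates_unit_ideal (alg_id (base_alg k)) I.
  by exists 1%N, (fun=> a), (fun=> b); rewrite big_ord1 mulrC.
by exists u; rewrite ue fmap_id.
Qed.
End LocalRing.

(** * Points of the quotient stack *)

Lemma collection_ext (T : Type) (V W : collection T) :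
  (forall x, V x <-> W x) -> V = W.
Proof. by move=> e; apply: funext => x; exact/propext. Qed.

Section QuotientSet.
Variables (T : Type) (E : T -> T -> Prop).

Lemma qclassP (C : quotient_set E) : exists x, qclass E x = C.
Proof.
case: C => S hS; have [x e] := hS; exists x.
by apply: eq_exist; rewrite e.
Qed.

Hypotheses (Exx : forall x, E x x) (Esym : forall x y, E x y -> E y x)
  (Etrans : forall x y z, E x y -> E y z -> E x z).

Lemma qclass_eqP x y : qclass E x = qclass E y <-> E x y.
Proof.
split=> [/(congr1 sval) /= -> //|xy]; apply: eq_exist; apply: collection_ext => z.
by split; [apply: Etrans; apply: Esym|apply: Etrans].
Qed.
End QuotientSet.

Section Topology.
Variables (T T' : Type) (O : opens T) (O' : opens T').

Lemma open_local (P : collection T) : is_topology O ->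
  (forall x, P x -> exists V, [/\ O V, V x & forall y, V y -> P y]) -> O P.
Proof.
move=> [_ _ OU] loc; have -> : P = fun x => exists2 V, O V /\ (forall y, V y -> P y) & V x.
  apply: collection_ext => x; split=> [/loc[V [OV Vx VP]]|[V [_ VP] Vx]].
    by exists V.
  exact: VP.
by apply: OU => V [].
Qed.

Lemma open_embedding_im (f : T -> T') (V : collection T) :
  is_topology O' -> open_embedding O O' f -> O V -> O' (im f V).
Proof.
move=> [_ O'I _] [[f_inj fO] fT] /fO [W O'W ->].
have -> : im f (preim f W) = fun y => W y /\ im f (fun=> True) y.
  apply: collection_ext => y; split=> [[x Wx <-]|[Wy [x _ fx]]].
    by split=> //; exists x.
  by exists x => //; rewrite /preim fx.
exact: O'I.
Qed.
End Topology.

Section FibredGroupoid.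
Variables (k : comPzRingType) (X : fibred_groupoid k) (S : scheme k).

Lemma fg_iso_refl (x : X S) : fg_iso x x.
Proof.
by exists (fg_id x), (fg_id x); rewrite fg_base_id fg_idl.
Qed.

Lemma fg_iso_sym (x y : X S) : fg_iso x y -> fg_iso y x.
Proof. by move=> [u [v [bu bv vu uv]]]; exists v, u. Qed.

Lemma nt_comp_id (Y Z : functor k) (f : nat_trans Y Z) : nt_comp f (nt_id Y) = f.
Proof. exact: nat_trans_ext. Qed.

(** Every arrow is cartesian, so one arrow over the identity is enough: lifting [fg_id y] through
    [u] gives a right inverse, and uniqueness of lifts through [u] makes it a left inverse. *)
Lemma fg_hom_iso (x y : X S) (u : fg_hom x y) : fg_base u = nt_id S -> fg_iso x y.
Proof.
move=> bu; have [|v [[bv uv] _]] := @fg_cartesian k X S S S y x y u (fg_id y) (nt_id S).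
  by rewrite fg_base_id bu nt_comp_id.
exists u, v; split=> //.
have [|w [_ wU]] := @fg_cartesian k X S S S x x y u u (nt_id S).
  by rewrite bu nt_comp_id.
have <- : w = fg_comp v u.
  by apply: wU; rewrite fg_base_comp bu bv nt_comp_id fg_assoc uv fg_idl.
by apply: wU; rewrite fg_base_id fg_idr.
Qed.

Lemma fg_iso_trans (x y z : X S) : fg_iso x y -> fg_iso y z -> fg_iso x z.
Proof.
move=> [u [_ [bu _ _ _]]] [v [_ [bv _ _ _]]]; apply: (fg_hom_iso (u := fg_comp v u)).
by rewrite fg_base_comp bu bv nt_comp_id.
Qed.
End FibredGroupoid.

Lemma iso_classes_eqP (k : comPzRingType) (X : fibred_groupoid k)
    (x y : X (spec_base k)) :
  qclass (@fg_iso k X (spec_base k)) x = qclass (@fg_iso k X (spec_base k)) y <->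
  fg_iso x y.
Proof.
apply: qclass_eqP; [exact: fg_iso_refl|exact: fg_iso_sym|exact: fg_iso_trans].
Qed.

Lemma spec_base_uniq (k : comPzRingType) (A : algebra k)
    (s s' : alg_hom (base_alg k) A) : s = s'.
Proof. by apply: alg_hom_ext => a; rewrite [LHS]alg_funE [RHS]alg_funE. Qed.

(** * Isomorphism classes of points of Y/G and orbits *)

Section QuotientPoints.
Variables (k : comPzRingType) (G : group_scheme k) (Y : scheme k) (a : action G Y).

Local Notation pi_k := (on_points (quotient_morphism a)).

Section PointHom.
Variables (S : scheme k) (x : quotient_ob a S) (t : x (base_alg k)).

Definition point_hom_map (y := qo_map x _ t) :
  nat_trans (quotient_map_ob a (point_morphism y)) x.
Proof.
refine (@NatTrans k (quotient_map_ob a (point_morphism y)) x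
  (fun A p => act (tact x) p.1 (fmap (p.2 : alg_hom (base_alg k) A) t)) _).
by move=> A B h [g s]; rewrite /= fmap_comp act_nat.
Defined.

(* A point t of a torsor gives the trivialization g |-> g t of its fibre. *)
Lemma point_hom : exists u : quotient_hom
    (quotient_map_ob a (point_morphism (qo_map x _ t))) x,
  qh_base u = point_morphism (proj x _ t).
Proof.
have e1 : equivariant (tact (quotient_map_ob a (point_morphism (qo_map x _ t))))
    (tact x) point_hom_map.
  by move=> A g p; rewrite /= act_mul.
have e2 : nt_comp (proj x) point_hom_map =
    nt_comp (point_morphism (proj x _ t))
      (proj (quotient_map_ob a (point_morphism (qo_map x _ t)))).
  by apply: nat_trans_ext => A p; rewrite /= proj_act nt_nat.
have e3 : nt_comp (qo_map x) point_hom_map =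
    qo_map (quotient_map_ob a (point_morphism (qo_map x _ t))).
  by apply: nat_trans_ext => A p; rewrite /= qo_equivariant nt_nat.
by exists (QuotientHom e1 e2 e3).
Qed.
End PointHom.

(** Spec k is final, so the arrow of [point_hom] lies over the identity and is an isomorphism. *)
Lemma pi_of_point (x : quotient_ob a (spec_base k)) (t : x (base_alg k)) :
  pi_k (qo_map x _ t) =
  qclass (@fg_iso k (quotient_stack a) (spec_base k)) x.
Proof.
have [u ub] := point_hom t; apply/iso_classes_eqP.
apply: (@fg_hom_iso k (quotient_stack a) (spec_base k) _ _ u).
rewrite [LHS]ub; apply: nat_trans_ext => A s; exact: spec_base_uniq.
Qed.

(** By Yoneda [f] is governed by its value at the identity of [U]. Both the value of [f] at the
    point below [t] and the trivial torsor attached to [t] map to this object over the same point of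
    [U], so the cartesian property identifies them. *)
Lemma on_points_torsor (U : scheme k) (f : one_morphism U (quotient_stack a))
    (t : (om_ob f (nt_id U) : quotient_ob a U) (base_alg k)) :
  on_points f (proj _ _ t) = pi_k (qo_map _ _ t).
Proof.
set x := (om_ob f (nt_id U) : quotient_ob a U) in t *.
have [w wb] := point_hom t.
have e : nt_comp (nt_id U) (point_morphism (proj x _ t)) = point_morphism (proj x _ t).
  exact: nat_trans_ext.
pose v := om_hom f e.
have [|u [[ub _] _]] := @fg_cartesian k (quotient_stack a) _ _ _
    (quotient_map_ob a (point_morphism (qo_map x _ t))) _ _ v w (nt_id _).
  by rewrite (om_base f e) nt_comp_id.
apply/esym/iso_classes_eqP; exact: (fg_hom_iso ub).
Qed.

(** The trivial torsor attached to [y] also has the point [g], which lies over [act a g y] in [Y];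
    [pi_of_point] does not depend on the point chosen. *)
Lemma pi_act (g : G (base_alg k)) (y : Y (base_alg k)) : pi_k (act a g y) = pi_k y.
Proof.
have := @pi_of_point (quotient_map_ob a (point_morphism y))
  ((g, alg_id (base_alg k)) : (quotient_map_ob a (point_morphism y)) (base_alg k)).
by rewrite /= fmap_id.
Qed.

(** An isomorphism from the trivial torsor of [y'] to that of [y] sends the unit to some [g].
    Compatibility with the maps to [Y] then says that [g] carries [y] to [y']; hence the reversal by
    [esym]. *)
Lemma pi_eq_orbit (y y' : Y (base_alg k)) : pi_k y = pi_k y' <-> same_orbit a y y'.
Proof.
split=> [/esym/iso_classes_eqP [u _]|[g <-]]; last by rewrite pi_act.
pose p : quotient_map_ob a (point_morphism y') (base_alg k) :=
  (gs_one G _, alg_id (base_alg k)).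
have /(congr1 (fun f => nt f p)) := qh_qo_map u.
rewrite /= act_one fmap_id; case: (qh_map u _ _) => g s /=.
by rewrite (spec_base_uniq s (alg_id _)) fmap_id => e; exists g.
Qed.

Lemma same_orbit_refl (y : Y (base_alg k)) : same_orbit a y y.
Proof. exact/pi_eq_orbit. Qed.
Lemma same_orbit_sym (y y' : Y (base_alg k)) : same_orbit a y y' -> same_orbit a y' y.
Proof. by move=> /pi_eq_orbit e; apply/pi_eq_orbit. Qed.
Lemma same_orbit_trans (y y' y'' : Y (base_alg k)) :
  same_orbit a y y' -> same_orbit a y' y'' -> same_orbit a y y''.
Proof. by move=> /pi_eq_orbit e /pi_eq_orbit e'; apply/pi_eq_orbit; rewrite e. Qed.
End QuotientPoints.

(** * Points and local sections of torsors under a special group *)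

Section SpecialTorsors.
Variables (k : comPzRingType) (G : group_scheme k).
Hypotheses (k_local : is_local_ring k) (G_special : special G).

Lemma trivial_torsor_section (U W : scheme k) (j : nat_trans U W) (T : torsor G W)
    (A : algebra k) (v : U A) :
  torsor_iso (pullback_torsor j T) (trivial_torsor G U) ->
  exists t : T A, proj T _ t = j _ v.
Proof.
move=> [e [e_iso _ ep]]; have [e' _ eK] := e_iso A.
pose p := e' (gs_one G A, v); exists (sval p).2.
rewrite -(svalP p); congr (j _ _).
have /(congr1 (fun f => nt f p)) /= <- := ep.
by rewrite eK.
Qed.

Lemma special_torsor_point (T : torsor G (spec_base k)) :
  inhabited (T (base_alg k)).
Proof.
have [[H [e [_ e_iso]]] triv] := G_special.
have [K [rho rho_unit]] := local_residue_field k_local.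
have sT : is_scheme T.
  exact: (torsor_is_scheme T e_iso (nt_id_iso (spec (base_alg k)))).
pose x : spec_base k (base_alg k) := alg_id (base_alg k).
have [U [j [j_open ju jT]]] := triv _ T sT K rho (fmap (str_hom (@Algebra k K rho)) x).
have [u _] := local_point_open rho_unit j_open ju.
by have [t _] := trivial_torsor_section u jT; exists.
Qed.

(** The chart Spec B serves twice: descent makes the restricted torsor a scheme because the base is
    affine, and a localization of [B] is again of finite type. Triviality is requested at the image
    of the closed point of Spec k. *)
Lemma special_torsor_locally_trivial (U : scheme k) (T : torsor G U)
    (u : U (base_alg k)) : locally_finite_type U ->
  exists (B : algebra k) (j : nat_trans (spec B) U) (b : B)
         (v : alg_hom (loc_alg b) (base_alg k)) (t : T (loc_alg b)),
    [/\ finite_type (alg_str B), open_immersion j,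
        j _ (alg_comp v (loc_hom b)) = u & proj T _ t = j _ (loc_hom b)].
Proof.
move=> U_lft; have [[H [e [_ e_iso]]] triv] := G_special.
have [K [rho rho_unit]] := local_residue_field k_local.
have [B [j [B_ft j_open ju]]] := U_lft K rho (fmap (str_hom (@Algebra k K rho)) u).
have [u0 u0E] := local_point_open rho_unit j_open ju.
pose T1 := pullback_torsor (j : nat_trans (spec_scheme B) U) T.
have sT1 : is_scheme T1 := torsor_is_scheme T1 e_iso (nt_id_iso (spec B)).
have [U1 [j1 [j1_open [w wE] j1T]]] :=
  triv (spec_scheme B) T1 sT1 K rho (fmap (str_hom (@Algebra k K rho)) u0).
have [_ /(_ B (alg_id B))[I [_ hI]]] := j1_open.
have : generates_unit_ideal (alg_comp (str_hom (@Algebra k K rho)) u0) I.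
  by apply/hI; exists w; rewrite wE; apply: alg_hom_ext.
(* [b] vanishes outside the trivializing open and not at the closed point. So the principal open of
   [b] lies in the trivializing one, and [u0] sends [b] to a unit of the local ring and factors
   through the localization. *)
move=> /unit_ideal_point [b [bI /rho_unit [c bc]]].
have [v vE] := loc_lift (h := u0) bc.
have [w' w'E] : exists w', j1 _ w' = fmap (loc_hom b) (alg_id B : spec B B).
  apply/hI; exists 1%N, (fun=> b), (fun=> loc_inv b); split=> //.
  by rewrite big_ord1 mulrC loc_homK.
have [[[s t] /= stE] tE] := trivial_torsor_section w' j1T.
exists B, j, b, v, t; split=> //; first by rewrite vE.
have -> : loc_hom b = s.
  by rewrite (tE : s = j1 _ w') w'E; exact: alg_hom_ext.
exact/esym.
Qed.
End SpecialTorsors.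

(** * Openness of the quotient map *)

Section ConradTopology.
Variables (R : preTopologicalComUnitRingType).
Hypothesis hR : topologically_suitable R.
Variable tau : forall Y : functor R, opens (Y (base_alg R)).
Hypothesis htau : is_conrad_topology (@tau).
Variables (G : group_scheme R) (Y : scheme R) (Y_lft : locally_finite_type Y).
Variable a : action G Y.

Local Notation pi_R := (on_points (quotient_morphism a)).

Definition translation (g : G (base_alg R)) : nat_trans Y Y.
Proof.
refine (@NatTrans R Y Y (fun A y => act a (fmap (str_hom A) g) y) _).
by move=> A B f y; rewrite act_nat -fmap_comp alg_hom_str.
Defined.

Lemma saturation_open (V : collection (Y (base_alg R))) :
  @tau Y V -> @tau Y (preim pi_R (im pi_R V)).
Proof.
move=> V_open; apply: (open_local (conrad_topology htau Y_lft)).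
move=> y [y' Vy' /esym/pi_eq_orbit [g gy]].
have trE z : translation g _ z = act a g z.
  congr (act a _ _); rewrite -[RHS]fmap_id; congr fmap; exact: spec_base_uniq.
exists (preim (@nt _ _ _ (translation g) (base_alg R)) V); split.
- exact: (@conrad_functorial _ _ htau _ _ (translation g) Y_lft Y_lft).
- by rewrite /preim trE gy.
- by move=> z; rewrite /preim trE => Vgz; exists (act a g z); rewrite // pi_act.
Qed.

Lemma quotient_map_open : special G ->
  open_map (@tau Y) (stack_topology (@tau) (quotient_stack a)) pi_R.
Proof.
move=> G_special V V_open U f U_lft.
have R_local : is_local_ring R by case: hR.
apply: (open_local (conrad_topology htau U_lft)) => u uV.
have [B [j [b [v [t [B_ft j_open jv tE]]]]]] :=
  special_torsor_locally_trivial R_local G_special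
    (om_ob f (nt_id U) : quotient_ob a U) u U_lft.
set T := (om_ob f (nt_id U) : quotient_ob a U) in t tE.
have S_lft := spec_scheme_lft (loc_finite_type b B_ft).
have B_lft := spec_scheme_lft B_ft.
pose phi_fun (A : algebra R) (h : alg_hom (loc_alg b) A) := fmap h (qo_map T _ t).
have phi_nat (A C : algebra R) (g : alg_hom A C) h :
    phi_fun C (fmap g (h : spec (loc_alg b) A)) = fmap g (phi_fun A h).
  exact: fmap_comp.
pose phi : nat_trans (spec_scheme (loc_alg b)) Y := NatTrans phi_nat.
have on_pt (h : alg_hom (loc_alg b) (base_alg R)) :
    on_points f (j _ (alg_comp h (loc_hom b))) = pi_R (phi _ h).
  have <- : proj T _ (fmap h t) = j _ (alg_comp h (loc_hom b)).
    by rewrite nt_nat tE -nt_nat.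
  by rewrite on_points_torsor nt_nat.
pose lm : nat_trans (spec_scheme (loc_alg b)) (spec_scheme B) := spec_map (loc_hom b).
pose jm : nat_trans (spec_scheme B) U := j.
(* The neighbourhood is pushed through the two open immersions one at a time, each inducing an open
   embedding on [R]-points. *)
exists (im (@nt _ _ _ jm _) (im (@nt _ _ _ lm _)
  (preim (@nt _ _ _ phi _) (preim pi_R (im pi_R V))))); split.
- apply: (open_embedding_im (conrad_topology htau U_lft)).
    exact: (conrad_open_immersion htau B_lft U_lft j_open).
  apply: (open_embedding_im (conrad_topology htau B_lft)).
    exact: (conrad_open_immersion htau S_lft B_lft (loc_open_immersion b)).
  apply: (@conrad_functorial _ _ htau _ _ phi S_lft Y_lft).
  exact: saturation_open.
- exists (alg_comp v (loc_hom b)) => //; exists v => //.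
  by rewrite /preim -on_pt jv.
- by move=> _ [_ [h hV <-] <-]; rewrite /preim [on_points _ _]on_pt.
Qed.
End ConradTopology.

Theorem proposition2p3p3p1
    (R : preTopologicalComUnitRingType)
    (hR : topologically_suitable R)
    (tau : forall Y : functor R, opens (Y (base_alg R)))
    (htau : is_conrad_topology tau)
    (G : group_scheme R)
    (G_flat : flat_functor G)
    (G_lfp : locally_finite_presentation G)
    (Y : scheme R)
    (Y_lft : locally_finite_type Y)
    (a : action G Y) :
  let pi_R := on_points (quotient_morphism a) in
  let O_Y := tau Y in
  let O_YG := stack_topology tau (quotient_stack a) in
  ((forall (g : G (base_alg R)) (y : Y (base_alg R)),
      pi_R (act a g y) = pi_R y) /\
   continuous_map O_Y O_YG pi_R) /\
  (special G ->
   [/\ forall x, exists y, pi_R y = x,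
       open_map O_Y O_YG pi_R &
       exists pi_bar : quotient_set (same_orbit a) -> iso_classes (quotient_stack a),
         (forall y, pi_bar (qclass (same_orbit a) y) = pi_R y) /\
         homeomorphism (quotient_opens O_Y) O_YG pi_bar]).
Proof.
move=> pi_R O_Y O_YG.
have pi_cont : continuous_map O_Y O_YG pi_R.
  (* The quotient morphism is itself one of the test morphisms that define the topology. *)
  by move=> V V_open; exact: (V_open Y (quotient_morphism a) Y_lft).
split; first by split=> // g y; exact: pi_act.
move=> G_special; have R_local : is_local_ring R by case: hR.
have pi_surj x : exists y, pi_R y = x.
  have [ob <-] := qclassP x.
  have [t] := special_torsor_point R_local G_special (ob : quotient_ob a _).
  by exists (qo_map _ _ t); exact: pi_of_point.
have pi_open := @quotient_map_open R hR tau htau G Y Y_lft a G_special.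
split=> //.
pose rep (C : quotient_set (same_orbit a)) := sval (cid (qclassP C)).
have repK C : qclass (same_orbit a) (rep C) = C by rewrite /rep; case: cid.
have orbP y y' : qclass (same_orbit a) y = qclass (same_orbit a) y' <-> same_orbit a y y'.
  apply: qclass_eqP; [exact: same_orbit_refl|exact: same_orbit_sym|].
  exact: same_orbit_trans.
pose sec x := sval (cid (pi_surj x)).
have secK x : pi_R (sec x) = x by rewrite /sec; case: cid.
pose pi_bar C := pi_R (rep C); pose inv x := qclass (same_orbit a) (sec x).
have pi_barE y : pi_bar (qclass (same_orbit a) y) = pi_R y.
  by apply/pi_eq_orbit/orbP; rewrite repK.
have invE y : inv (pi_R y) = qclass (same_orbit a) y.
  by apply/orbP/pi_eq_orbit; rewrite -/pi_R secK.
exists pi_bar; split=> //; exists inv; split.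
- by move=> C; rewrite -(repK C) pi_barE invE.
- by move=> x; rewrite pi_barE secK.
- move=> V /pi_cont V_open.
  rewrite /quotient_opens; have -> // :
    preim (@qclass _ (same_orbit a)) (preim pi_bar V) = preim pi_R V.
  by apply: collection_ext => y; rewrite /preim pi_barE.
(* Continuity of the inverse is openness of [pi_R]: the preimage of [V] under [inv] is the image
   under [pi_R] of the set of points whose orbit lies in [V]. *)
- move=> V /pi_open V_open; have -> // : preim inv V =
    im pi_R (preim (@qclass _ (same_orbit a)) V).
  apply: collection_ext => x; split=> [Vx|[y Vy <-]].
    by exists (sec x).
  by rewrite /preim invE.
Qed.
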